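(* Let $(V,\omega)$ be a $2n$-dimensional real symplectic vector space, $L_0,L_1,L_2\in\Lambda(V,\omega)$, and $\psi:[0,T]\to\mathrm{Sp}(V,\omega)$ continuous with $\psi(0)=\mathrm{Id}$. For $t\in[0,T]$ set $\ell_1(t)=\psi(t)L_1$, $\ell_2(t)=\psi(t)L_2$, $\mu_0(t)=\psi(t)^{-1}L_0$. Let $\epsilon_a=L_1\cap L_2+L_2\cap L_0$, $\epsilon_b=L_1\cap L_2+L_2\cap\mu_0(T)$ and $k=\min\{\dim\epsilon_a,\dim\epsilon_b\}$. Then $$\Big|\iota^{\mathrm{CLM}}\big(L_0,\ell_1(t);t\in[0,T]\big)-\iota^{\mathrm{CLM}}\big(L_0,\ell_2(t);t\in[0,T]\big)\Big|\le n-k.$$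
   Context: $\mathrm{Sp}(V,\omega)$ is the group of linear automorphisms of $V$ preserving $\omega$. Let $(V,\omega)$ be a real symplectic vector space of dimension $2n$ and $\Lambda(V,\omega)$ its Lagrangian Grassmannian (the $n$-dimensional subspaces $L$ with $\omega|_{L\times L}=0$). For $L_0\in\Lambda(V,\omega)$ and a continuous path $\ell:[a,b]\to\Lambda(V,\omega)$, $\iota^{\mathrm{CLM}}(L_0,\ell(t);t\in[a,b])\in\mathbb Z$ denotes the Cappell–Lee–Miller Maslov index: the intersection index of $\ell$ with the Maslov cycle $\Sigma(L_0)=\{L\in\Lambda(V,\omega): L\cap L_0\neq\{0\}\}$; it is invariant under homotopies of $\ell$ with fixed endpoints, additive under concatenation of paths, and for $\mathscr C^1$ paths all of whose crossings are regular it is given by $\iota^{\mathrm{CLM}}(L_0,\ell(t);t\in[a,b])=n_+\big(\Gamma(\ell,L_0,a)\big)+\sum_{a<t<b}\operatorname{sgn}\Gamma(\ell,L_0,t)-n_-\big(\Gamma(\ell,L_0,b)\big)$. Here a crossing is an instant $t_0$ with $\ell(t_0)\cap L_0\neq\{0\}$; the crossing form $\Gamma(\ell,L_0,t_0)$ is the quadratic form on $\ell(t_0)\cap L_0$ defined by choosing $W\in\Lambda(V,\omega)$ transversal to $\ell(t_0)$, letting, for $v\in\ell(t_0)$ and $t$ near $t_0$, $w(t)\in W$ be the unique vector with $v+w(t)\in\ell(t)$, and setting $\Gamma(\ell,L_0,t_0)[v]=\frac{d}{dt}\big|_{t=t_0}\omega(v,w(t))$; a crossing is regular if this form is nondegenerate;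 $n_+,n_-$ denote positive and negative inertia indices and $\operatorname{sgn}=n_+-n_-$. *)

(* Defs.v *)
From HB Require Import structures.
From mathcomp Require Import all_boot all_order all_algebra.
From mathcomp Require Import all_classical all_reals all_analysis.
Set Implicit Arguments. Unset Strict Implicit. Unset Printing Implicit Defensive.
Import Order.TTheory GRing.Theory Num.Theory.
Import numFieldNormedType.Exports.
Local Open Scope classical_set_scope.
Local Open Scope ring_scope.

(* Conventions.  V = row vectors 'rV[R]_(n + n); a symplectic form is given by a
   skew-symmetric invertible matrix Om, omega(u,v) = u Om v^T.
   A linear map acts on the right: v |-> v *m A.
   A linear subspace is the row space of a square matrix (mxalgebra).
   A Lagrangian subspace, as a POINT of the Lagrangian Grassmannian, is
   represented canonically by its orthogonal projector (symmetric idempotent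
   matrix), so that the topology / C^1 structure of Lambda(V,omega) is the one
   induced from the matrix space. *)

Section Symp.
Variable R : realType.
Variable n : nat.
Notation m := (n + n)%N.
Variable Om : 'M[R]_m.

Definition sympl_form : Prop := Om^T = - Om /\ Om \in unitmx.

Definition omega (u v : 'rV[R]_m) : R := (u *m Om *m v^T) 0 0.

Definition sympl_map (A : 'M[R]_m) : Prop := A *m Om *m A^T = Om.

Definition lagr (P : 'M[R]_m) : Prop :=
  P^T = P /\ P *m P = P /\ \rank P = n /\
  (forall u v : 'rV[R]_m, (u <= P)%MS -> (v <= P)%MS -> omega u v = 0).

Definition oproj (M : 'M[R]_m) : 'M[R]_m :=
  (row_base M)^T *m invmx (row_base M *m (row_base M)^T) *m row_base M.

Definition lag_path (l : R -> 'M[R]_m) (a b : R) : Prop :=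
  (forall t, a <= t <= b -> lagr (l t)) /\
  {within [set t | a <= t <= b], continuous l}.

Definition crossing (L0 : 'M[R]_m) (l : R -> 'M[R]_m) (t : R) : bool :=
  (l t :&: L0 != (0 : 'M[R]_m))%MS.

(* Crossing form Gamma(l, L0, t0) computed with a Lagrangian W transversal to
   l(t0): for v in l(t0), w(t) in W is the unique vector with v + w(t) in l(t),
   i.e. w(t) = - v * proj_mx W (l t) (projection onto W along l(t)). *)
Definition crossing_form (l : R -> 'M[R]_m) (t0 : R) (W : 'M[R]_m)
  (v : 'rV[R]_m) : R :=
  derive1 (fun t => omega v (- (v *m proj_mx W (l t)))) t0.

Definition posdef_on (q : 'rV[R]_m -> R) (U : 'M[R]_m) : Prop :=
  forall u : 'rV[R]_m, (u <= U)%MS -> u != 0 -> 0 < q u.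

Definition n_plus (q : 'rV[R]_m -> R) (S : 'M[R]_m) : nat :=
  \big[maxn/0%N]_(k < m.+1 |
     `[< exists U : 'M[R]_m, (U <= S)%MS /\ \rank U = k /\ posdef_on q U >]) k.

Definition n_minus (q : 'rV[R]_m -> R) (S : 'M[R]_m) : nat :=
  n_plus (fun v => - q v) S.

Definition sgn_form (q : 'rV[R]_m -> R) (S : 'M[R]_m) : int :=
  (n_plus q S)%:Z - (n_minus q S)%:Z.

Definition nondeg_on (q : 'rV[R]_m -> R) (S : 'M[R]_m) : Prop :=
  forall u : 'rV[R]_m, (u <= S)%MS ->
    (forall v : 'rV[R]_m, (v <= S)%MS -> q (u + v) - q u - q v = 0) -> u = 0.

(* iota L0 l a b stands for iota^CLM(L0, l(t); t in [a,b]).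
   is_CLM iota: iota satisfies the defining properties of the
   Cappell-Lee-Miller index listed in the paper (which determine it uniquely). *)
Definition is_CLM (iota : 'M[R]_m -> (R -> 'M[R]_m) -> R -> R -> int) : Prop :=
  (forall L0 (l0 l1 : R -> 'M[R]_m) (H : R -> R -> 'M[R]_m) a b,
      lagr L0 -> a <= b -> lag_path l0 a b -> lag_path l1 a b ->
      (forall s t, 0 <= s <= 1 -> a <= t <= b -> lagr (H s t)) ->
      {within [set p : R * R | 0 <= p.1 <= 1 /\ a <= p.2 <= b],
         continuous (fun p : R * R => H p.1 p.2)} ->
      (forall t, a <= t <= b -> H 0 t = l0 t /\ H 1 t = l1 t) ->
      (forall s, 0 <= s <= 1 -> H s a = l0 a /\ H s b = l0 b) ->
      iota L0 l0 a b = iota L0 l1 a b) /\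
  (forall L0 (l : R -> 'M[R]_m) a c b,
      lagr L0 -> a <= c -> c <= b -> lag_path l a b ->
      iota L0 l a b = iota L0 l a c + iota L0 l c b) /\
  (forall L0 (l : R -> 'M[R]_m) (Wc : R -> 'M[R]_m) a b (s : seq R),
      lagr L0 -> a < b ->
      (forall t, lagr (l t)) ->
      (forall t, derivable l t 1) -> continuous ('D_1 l) ->
      (forall t, lagr (Wc t) /\ (Wc t :&: l t == (0 : 'M[R]_m))%MS) ->
      (forall t, a <= t <= b -> crossing L0 l t ->
         nondeg_on (crossing_form l t (Wc t)) (l t :&: L0)%MS) ->
      uniq s ->
      (forall t, t \in s <-> (a < t < b /\ crossing L0 l t)) ->
      iota L0 l a b =
        (n_plus (crossing_form l a (Wc a)) (l a :&: L0)%MS)%:Z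
        + \sum_(t <- s) sgn_form (crossing_form l t (Wc t)) (l t :&: L0)%MS
        - (n_minus (crossing_form l b (Wc b)) (l b :&: L0)%MS)%:Z).

End Symp.

(* Main.v *)
Require Import Defs.
From HB Require Import structures.
From mathcomp Require Import all_boot all_order all_algebra.
From mathcomp Require Import all_classical all_reals all_analysis.
From mathcomp Require Import ring lra zify.
Set Implicit Arguments. Unset Strict Implicit. Unset Printing Implicit Defensive.
Import Order.TTheory GRing.Theory Num.Theory.
Import numFieldNormedType.Exports.
Local Open Scope classical_set_scope.
Local Open Scope ring_scope.

(** Choose frames [X2], [X1] of [L2], [L1] with [X2 Om X1^T = - D] for an
    orthogonal projector [D] whose kernel corresponds to [L1 :&: L2].  All
    members of the pencil [X2 + u (X1 - X2)] are Lagrangian frames, and the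
    pencil joins [L2] to [L1] in the negative direction.  Sweeping it by [psi]
    and using homotopy invariance, the difference of the two indices becomes the
    index of the pencil moved by [psi T] minus the index of the pencil itself.

    The index of the pencil lies between [rank (L1 :&: L2 + L2 :&: L0) - n] and
    [0], and likewise for the moved pencil.  It crosses [L0] degenerately only
    along [L1 :&: L2 :&: L0]; bending it by a symplectic shear that is trivial at
    both ends makes all crossings regular, with no positive contribution.
    Vectors of [L0] lying on two distinct members of the pencil have
    [D]-orthogonal coordinates, so the negative contributions, together with the
    coordinates of [L1 :&: L2 + L2 :&: L0], are independent in an
    [n]-dimensional space. *)

(** * Row projectors and Lagrangian frames *)

Lemma dotrv_ge0 (R : realFieldType) p (x : 'rV[R]_p) : 0 <= (x *m x^T) 0 0.
Proof.
by rewrite mxE; apply: sumr_ge0 => i _; rewrite mxE -expr2 sqr_ge0.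
Qed.

Lemma dotrv_eq0 (R : realFieldType) p (x : 'rV[R]_p) :
  (x *m x^T) 0 0 = 0 -> x = 0.
Proof.
rewrite mxE => /eqP; rewrite psumr_eq0 => [/allP x0|i _]; last first.
  by rewrite mxE -expr2 sqr_ge0.
apply/rowP => i; have := x0 i (mem_index_enum i).
by rewrite !mxE -expr2 sqrf_eq0 => /eqP.
Qed.

Lemma gram_unitmx (R : realFieldType) r p (X : 'M[R]_(r, p)) :
  row_free X -> X *m X^T \in unitmx.
Proof.
move=> fX; rewrite -row_free_unit -kermx_eq0; apply/eqP/row_matrixP => i.
rewrite row0; set x := row i _.
have : x *m (X *m X^T) = 0 by apply/sub_kermxP; exact: row_sub.
move=> /(congr1 (fun y => (y *m x^T) 0 0)).
rewrite mul0mx [in RHS]mxE mulmxA -mulmxA -trmx_mul => /dotrv_eq0 xX0.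
by apply: (row_free_inj fX); rewrite xX0 mul0mx.
Qed.

(** A pseudo-inverse of [E *m Om] provides a dual [G]. Its Gram matrix [A] is skew, and subtracting
    half of [A *m E] from [G] cancels it without disturbing the pairing with the isotropic [E]. *)
Lemma isotropic_dual (R : numFieldType) r p (Om : 'M[R]_p) (E : 'M[R]_(r, p)) :
    Om^T = - Om -> Om \in unitmx -> row_free E -> E *m Om *m E^T = 0 ->
  exists F : 'M[R]_(r, p), E *m Om *m F^T = 1%:M /\ F *m Om *m F^T = 0.
Proof.
move=> OmT Omu fE E0.
have fEO : row_free (E *m Om) by rewrite /row_free mxrankMfree ?row_free_unit.
pose G := (pinvmx (E *m Om))^T.
have EG : E *m Om *m G^T = 1%:M by rewrite trmxK mulmxVp.
have GE : G *m Om *m E^T = - 1%:M.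
  apply: trmx_inj; rewrite !trmx_mul trmxK OmT mulNmx mulmxN mulmxA EG.
  by rewrite linearN /= trmx1.
pose A := G *m Om *m G^T.
have AT : A^T = - A.
  by rewrite /A !trmx_mul trmxK OmT mulNmx mulmxN mulmxA.
exists (G - 2%:R^-1 *: A *m E); split.
  by rewrite linearB /= mulmxBr EG trmx_mul mulmxA E0 mul0mx subr0.
set B := 2%:R^-1 *: A.
have BT : B^T = - B by rewrite /B linearZ /= AT scalerN.
transitivity (A - G *m Om *m E^T *m B^T - B *m (E *m Om *m G^T)
              + B *m (E *m Om *m E^T) *m B^T).
  by rewrite linearB /= trmx_mul !mulmxBl !mulmxBr !mulmxA opprB addrA addrAC.
rewrite EG GE E0 mulmx0 mul0mx addr0 BT mulmxN mulNmx mul1mx opprK mulmx1.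
by rewrite -addrA -opprD /B -scalerDl -div1r -splitr scale1r subrr.
Qed.

(** Equal row spaces give [P Q = P] and [Q P = Q]; transposing the first yields [Q P = P]. *)
Lemma sym_idem_inj (R : fieldType) p (P Q : 'M[R]_p) :
  P^T = P -> P *m P = P -> Q^T = Q -> Q *m Q = Q -> (P :=: Q)%MS -> P = Q.
Proof.
move=> PT PP QT QQ PQ.
have mulP A B : A *m A = A -> (B <= A)%MS -> B *m A = B :> 'M[R]_p.
  by move=> AA /submxP[C ->]; rewrite -mulmxA AA.
have PQP : P *m Q = P by apply: mulP; rewrite // PQ.
have QPQ : Q *m P = Q by apply: mulP; rewrite // PQ.
by rewrite -{1}PT -PQP trmx_mul PT QT.
Qed.

(* Written with [\adj] instead of [invmx], so that it is visibly a rational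
   function of the entries of [X]; meaningful only when [X] is row free. *)
Definition rproj (R : realFieldType) r p (X : 'M[R]_(r, p)) : 'M[R]_p :=
  (\det (X *m X^T))^-1 *: (X^T *m \adj (X *m X^T) *m X).

Section RowProjector.
Variables (R : realFieldType) (r p : nat) (X : 'M[R]_(r, p)).
Hypothesis fX : row_free X.

Lemma rprojE : rproj X = X^T *m invmx (X *m X^T) *m X.
Proof. by rewrite /invmx gram_unitmx// -scalemxAr -scalemxAl. Qed.

Lemma tr_rproj : (rproj X)^T = rproj X.
Proof.
by rewrite rprojE !trmx_mul trmx_inv trmx_mul !trmxK mulmxA.
Qed.

Lemma mul_rproj : X *m rproj X = X.
Proof. by rewrite rprojE !mulmxA mulmxV ?mul1mx// gram_unitmx. Qed.

Lemma rproj_idem : rproj X *m rproj X = rproj X.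
Proof. by rewrite {1}rprojE -!mulmxA mul_rproj mulmxA -rprojE. Qed.

Lemma rproj_eqmx : (rproj X :=: X)%MS.
Proof.
apply/eqmxP/andP; split; first by rewrite rprojE submxMl.
by rewrite -{1}mul_rproj submxMl.
Qed.

Lemma sym_idem_rproj (P : 'M[R]_p) :
  P^T = P -> P *m P = P -> (P :=: X)%MS -> P = rproj X.
Proof.
move=> PT PP PX; apply: sym_idem_inj; rewrite ?tr_rproj ?rproj_idem//.
exact: eqmx_trans PX (eqmx_sym rproj_eqmx).
Qed.

End RowProjector.

Lemma eq_rproj (R : realFieldType) r s p (X : 'M[R]_(r, p)) (Y : 'M[R]_(s, p)) :
  row_free X -> row_free Y -> (X :=: Y)%MS -> rproj X = rproj Y.
Proof.
move=> fX fY XY; apply: sym_idem_rproj => //; rewrite ?tr_rproj ?rproj_idem//.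
exact: eqmx_trans (rproj_eqmx fX) XY.
Qed.

(** The basis [row_base M] inside [oproj] need not vary continuously with [M]; this trades it for
    any chosen frame, in particular one that does. *)
Lemma oproj_rproj (R : realType) n r (M : 'M[R]_(n + n))
    (X : 'M[R]_(r, n + n)) :
  row_free X -> (M :=: X)%MS -> oproj M = rproj X.
Proof.
move=> fX MX; have fM := row_base_free M.
rewrite /oproj -rprojE//; apply: eq_rproj => //.
exact: eqmx_trans (eq_row_base M) MX.
Qed.

Section Frames.
Variables (R : realType) (n : nat) (Om : 'M[R]_(n + n)).
Hypothesis OmS : sympl_form Om.
Let OmT : Om^T = - Om. Proof. exact: OmS.1. Qed.
Let Omu : Om \in unitmx. Proof. exact: OmS.2. Qed.

Definition frame (X : 'M[R]_(n, n + n)) := row_free X /\ X *m Om *m X^T = 0.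

Lemma tr_form r s (X : 'M[R]_(r, n + n)) (Y : 'M[R]_(s, n + n)) :
  (X *m Om *m Y^T)^T = - (Y *m Om *m X^T).
Proof. by rewrite !trmx_mul trmxK OmT mulNmx mulmxN mulmxA. Qed.

Lemma frame_lagr X : frame X -> lagr Om (rproj X).
Proof.
move=> [fX X0]; split; first exact: tr_rproj.
split; first exact: rproj_idem.
split; first by rewrite (rproj_eqmx fX); apply/eqP.
move=> u v; rewrite !(rproj_eqmx fX) => /submxP[x ->] /submxP[y ->].
rewrite /omega trmx_mul mulmxA -(mulmxA x) -(mulmxA x) X0 mulmx0 mul0mx.
by rewrite mxE.
Qed.

Lemma lagr_isotropic P r s (X : 'M[R]_(r, n + n)) (Y : 'M[R]_(s, n + n)) :
  lagr Om P -> (X <= P)%MS -> (Y <= P)%MS -> X *m Om *m Y^T = 0.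
Proof.
move=> [_ [_ [_ P0]]] XP YP; apply/matrixP => i j; rewrite [RHS]mxE.
rewrite -(P0 (row i X) (row j Y)) ?(submx_trans (row_sub _ _))//.
rewrite /omega -!row_mul tr_row !mxE.
by apply: eq_bigr => k _; rewrite !mxE.
Qed.

Lemma lagr_frame P : lagr Om P ->
  exists X, frame X /\ (P :=: X)%MS.
Proof.
move=> LP; have rP : \rank P = n by case: LP => _ [_ []].
have [X [fX XP]] : exists X : 'M[R]_(n, n + n), row_free X /\ (X :=: P)%MS.
  have : exists X : 'M[R]_(\rank P, n + n), row_free X /\ (X :=: P)%MS.
    by exists (row_base P); split; [exact: row_base_free|exact: eq_row_base].
  by rewrite rP.
exists X; split; last exact: eqmx_sym.
by split=> //; apply: (lagr_isotropic LP); rewrite XP.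
Qed.

(** [X] and [V] both lie in the kernel of [Om *m X^T], whose dimension [(n + n) - n] is already
    attained by [X]. *)
Lemma frame_max X r (V : 'M[R]_(r, n + n)) :
  frame X -> V *m Om *m X^T = 0 -> (V <= X)%MS.
Proof.
move=> [fX X0] V0.
have XK : (X <= kermx (Om *m X^T))%MS by apply/sub_kermxP; rewrite mulmxA.
have VK : (V <= kermx (Om *m X^T))%MS by apply/sub_kermxP; rewrite mulmxA.
apply: submx_trans VK _; rewrite -(mxrank_leqif_sup XK).
have rX : \rank X = n by apply/eqP.
rewrite mxrank_ker -(mxrank_tr (Om *m _)) trmx_mul trmxK.
by rewrite mxrankMfree ?row_free_unit ?unitmx_tr// rX addnK.
Qed.

Lemma sympl_map_unitmx A : sympl_map Om A -> A \in unitmx.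
Proof.
by move=> SA; move: Omu; rewrite -SA !unitmx_mul => /andP[/andP[]].
Qed.

Lemma frame_sympl X A : frame X -> sympl_map Om A -> frame (X *m A).
Proof.
move=> [fX X0] SA; split.
  by rewrite /row_free mxrankMfree ?row_free_unit ?sympl_map_unitmx.
by rewrite trmx_mul !mulmxA -(mulmxA X) -(mulmxA X) SA.
Qed.

End Frames.

(** * Adapted pencils and shears *)

Section Pencil.
Variables (R : realType) (n : nat) (Om : 'M[R]_(n + n)).
Hypothesis OmS : sympl_form Om.
Let OmT : Om^T = - Om. Proof. exact: OmS.1. Qed.

(** The two frames agree on the kernel of [D] (acting on row coordinates) and are dual up to sign on
    its image. The sign in [- D] is what makes the pencil move in the negative direction. *)
Definition adapted (X2 X1 : 'M[R]_(n, n + n)) (D : 'M[R]_n) :=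
  [/\ frame Om X2, frame Om X1, D^T = D, D *m D = D &
      X2 *m Om *m X1^T = - D /\ (1%:M - D) *m X2 = (1%:M - D) *m X1].

Definition pencil (X2 X1 : 'M[R]_(n, n + n)) (u : R) := X2 + u *: (X1 - X2).

(** The rank factorization of the pairing matrix [B] gives bases whose pairing is a [pid_mx].
    Combinations of [Y2] orthogonal to all of [Y1] lie in [Y1] by maximality, so both frames can
    share them. *)
Lemma adapted_exists Y2 Y1 : frame Om Y2 -> frame Om Y1 ->
  exists X2 X1 D, [/\ adapted X2 X1 D, (X2 :=: Y2)%MS & (X1 :=: Y1)%MS].
Proof.
move=> fY2 fY1; pose B := Y2 *m Om *m Y1^T.
have [D [DT DD [X2 [Z1 [X2Y2 Z1Y1 X2Z1 X2Y1]]]]] : exists D : 'M[R]_n,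
    [/\ D^T = D, D *m D = D & exists X2 Z1 : 'M[R]_(n, n + n),
    [/\ (X2 :=: Y2)%MS, (Z1 <= Y1)%MS, X2 *m Om *m Z1^T = D &
       (1%:M - D) *m X2 *m Om *m Y1^T = 0]].
  exists (pid_mx (\rank B)); have DD := @pid_mx_id R n n n (\rank B).
  rewrite {}DD ?rank_leq_row// tr_pid_mx; split=> //.
  exists (invmx (col_ebase B) *m Y2), ((invmx (row_ebase B))^T *m Y1).
  have X2Y1 : invmx (col_ebase B) *m Y2 *m Om *m Y1^T
      = pid_mx (\rank B) *m row_ebase B.
    rewrite -!mulmxA (mulmxA Y2) -/B -[in X in _ *m X](mulmx_ebase B).
    by rewrite !mulmxA mulVmx ?mul1mx// col_ebase_unit.
  split.
  - by apply: eqmxMfull; rewrite row_full_unit unitmx_inv col_ebase_unit.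
  - exact: submxMl.
  - by rewrite [_^T]trmx_mul trmxK mulmxA X2Y1 mulmxK ?row_ebase_unit.
  - rewrite -(mulmxA _ _ Om) -(mulmxA _ _ Y1^T) X2Y1.
    by rewrite mulmxA mulmxBl mul1mx pid_mx_id ?rank_leq_row// subrr mul0mx.
have rY2 : \rank Y2 = n by apply/eqP; case: fY2.
have rY1 : \rank Y1 = n by apply/eqP; case: fY1.
have fX2 : row_free X2 by rewrite /row_free X2Y2 rY2.
have X20 : X2 *m Om *m X2^T = 0.
  have /submxP[a ->] : (X2 <= Y2)%MS by rewrite X2Y2.
  by rewrite trmx_mul !mulmxA -(mulmxA a) -(mulmxA a) fY2.2 mulmx0 mul0mx.
(* [(1 - D) X2] lies in [Y1] and is kept; the other coordinates come from [Z1], with a sign that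
   turns the pairing [D] into [- D]. *)
pose X1 := (1%:M - D) *m X2 - D *m Z1.
have P0 : (1%:M - D) *m D = 0 by rewrite mulmxBl mul1mx DD subrr.
have X2X1 : X2 *m Om *m X1^T = - D.
  by rewrite linearB /= mulmxBr !trmx_mul linearB /= DT !mulmxA X2Z1 X20 trmx1
    mul0mx sub0r DD.
have kX : (1%:M - D) *m X2 = (1%:M - D) *m X1.
  have PP : (1%:M - D) *m (1%:M - D) = 1%:M - D.
    by rewrite mulmxBr mulmx1 P0 subr0.
  by rewrite /X1 mulmxBr !mulmxA PP P0 mul0mx subr0.
have X1Y1 : (X1 <= Y1)%MS.
  apply: (frame_max OmS fY1); case/submxP: Z1Y1 => b Z1Y1.
  rewrite /X1 !mulmxBl in X2Y1 *; rewrite X2Y1 Z1Y1 sub0r -!mulmxA (mulmxA Y1).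
  by rewrite fY1.2 !mulmx0 oppr0.
have fX1 : row_free X1.
  rewrite -kermx_eq0; apply/eqP/row_matrixP => i; rewrite row0.
  set x := row i _.
  have xX1 : x *m X1 = 0 by apply/sub_kermxP; exact: row_sub.
  have xD : x *m D = 0.
    rewrite -DT -[D]opprK -X2X1 linearN /= tr_form// opprK.
    by rewrite !mulmxA xX1 !mul0mx.
  have /(congr1 (mulmx x)) := kX.
  rewrite !mulmxA mulmxBr mulmx1 xD subr0 xX1 => xX2.
  by apply: (row_free_inj fX2); rewrite xX2 mul0mx.
have X10 : X1 *m Om *m X1^T = 0.
  case/submxP: X1Y1 => a ->.
  by rewrite trmx_mul !mulmxA -(mulmxA a) -(mulmxA a) fY1.2 mulmx0 mul0mx.
exists X2, X1, D; split => //; apply/eqmxP.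
apply/andP; split=> //; have [_ <-] := mxrank_leqif_sup X1Y1.
by rewrite rY1; exact: fX1.
Qed.

Section Adapted.
Variables (X2 X1 : 'M[R]_(n, n + n)) (D : 'M[R]_n).
Hypothesis aX : adapted X2 X1 D.

Lemma adapted_ker r (x : 'M[R]_(r, n)) u :
  x *m D = 0 -> x *m X1 = x *m X2 /\ x *m pencil X2 X1 u = x *m X2.
Proof.
case: aX => _ _ _ _ [_ kX] xD.
have xX : x *m X1 = x *m X2.
  have /(congr1 (mulmx x)) := kX.
  by rewrite !mulmxA mulmxBr mulmx1 xD subr0.
split=> //; rewrite /pencil mulmxDr -scalemxAr mulmxBr xX subrr scaler0.
by rewrite addr0.
Qed.

(** For [u = v] every member is isotropic; for [u <> v] the isotropy of [L0] becomes
    [D]-orthogonality of the coordinates of its vectors lying in the two members. *)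
Lemma pencil_form u v :
  pencil X2 X1 u *m Om *m (pencil X2 X1 v)^T = (u - v) *: D.
Proof.
case: aX => -[_ X20] [_ X10] DT _ [X21 _].
have X12 : X1 *m Om *m X2^T = D.
  by rewrite -[LHS]opprK -tr_form// X21 linearN /= DT opprK.
have -> : (pencil X2 X1 v)^T = X2^T + v *: (X1^T - X2^T).
  by apply/matrixP => i j; rewrite !mxE.
rewrite /pencil !(mulmxDl, mulmxDr, mulmxN, mulNmx,
                  =^~ scalemxAl, =^~ scalemxAr) X20 X10 X12 X21.
apply/matrixP => i j; rewrite !mxE; ring.
Qed.

Lemma pencil_frame u : frame Om (pencil X2 X1 u).
Proof.
split; last by rewrite pencil_form subrr scale0r.
rewrite -kermx_eq0; apply/eqP/row_matrixP => i; rewrite row0.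
set x := row i _.
have xX : x *m pencil X2 X1 u = 0 by apply/sub_kermxP; exact: row_sub.
have xD : x *m D = 0.
  (* Any other member would do; [u + 1] makes the coefficient of [D] equal to [-1]. *)
  have := pencil_form u (u + 1).
  move=> /(congr1 (mulmx x)); rewrite !mulmxA xX !mul0mx opprD addNKr scaleN1r.
  by rewrite mulmxN => /esym/eqP; rewrite oppr_eq0 => /eqP.
have [_] := adapted_ker u xD; rewrite xX => /esym xX2.
by case: aX => -[fX2 _] _ _ _ _; apply: (row_free_inj fX2); rewrite xX2 mul0mx.
Qed.

Lemma adapted_quad (x : 'rV[R]_n) :
  (x *m D *m x^T) 0 0 = ((x *m D) *m (x *m D)^T) 0 0.
Proof.
by case: aX => _ _ DT DD _; rewrite trmx_mul DT !mulmxA -(mulmxA x D D) DD.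
Qed.

Lemma adapted_quad_ge0 (x : 'rV[R]_n) : 0 <= (x *m D *m x^T) 0 0.
Proof. by rewrite adapted_quad dotrv_ge0. Qed.

Lemma adapted_quad_eq0 (x : 'rV[R]_n) : (x *m D *m x^T) 0 0 = 0 -> x *m D = 0.
Proof. by rewrite adapted_quad => /dotrv_eq0. Qed.

Lemma adapted_sympl A : sympl_map Om A -> adapted (X2 *m A) (X1 *m A) D.
Proof.
case: aX => fX2 fX1 DT DD [X21 kX] SA; split=> //; rewrite ?mulmxA ?kX.
- exact: frame_sympl.
- exact: frame_sympl.
- split=> //; rewrite trmx_mul !mulmxA -(mulmxA X2 A) -(mulmxA X2).
  by rewrite SA.
Qed.

Lemma pencil_mul A u : pencil (X2 *m A) (X1 *m A) u = pencil X2 X1 u *m A.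
Proof. by rewrite /pencil mulmxDl -scalemxAl mulmxBl. Qed.

End Adapted.

Lemma adapted_const X : frame Om X -> adapted X X 0.
Proof.
move=> fX; split=> //; rewrite ?trmx0 ?mul0mx//; split=> //.
by rewrite oppr0; case: fX.
Qed.

Section Shear.
Variables (r : nat) (F : 'M[R]_(r, n + n)).
Hypothesis F0 : F *m Om *m F^T = 0.

(** The map sending [v] to [v + a omega(v, F) F]: a product of commuting transvections along the
    rows of the isotropic [F]. *)
Definition shear (a : R) : 'M[R]_(n + n) := 1%:M + a *: (Om *m F^T *m F).

Lemma shear0 : shear 0 = 1%:M.
Proof. by rewrite /shear scale0r addr0. Qed.

Lemma mul_shear s (v : 'M[R]_(s, n + n)) a :
  v *m shear a = v + a *: (v *m Om *m F^T *m F).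
Proof. by rewrite /shear mulmxDr mulmx1 -scalemxAr !mulmxA. Qed.

Lemma shear_form a b :
  shear a *m Om *m (shear b)^T = Om + (a - b) *: (Om *m F^T *m F *m Om).
Proof.
have -> : (shear b)^T = 1%:M + b *: (Om *m F^T *m F)^T.
  by apply/matrixP => i j; rewrite !mxE eq_sym.
rewrite /shear !trmx_mul trmxK OmT.
rewrite !(mulmxDl, mulmxDr, =^~ scalemxAl, =^~ scalemxAr) !mulmx1 mul1mx.
rewrite !mulmxN !mulmxA -(mulmxA _ F Om) -(mulmxA _ (F *m Om)) F0.
rewrite mulmx0 !mul0mx oppr0 !scaler0 addr0 scalerBl scalerN -!mulmxA.
by rewrite addrA.
Qed.

Lemma mul_shear_form p q (V : 'M[R]_(p, n + n)) (W : 'M[R]_(q, n + n)) a b :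
  V *m shear a *m Om *m (W *m shear b)^T = V *m Om *m W^T
    + (a - b) *: (V *m Om *m F^T *m (F *m Om *m W^T)).
Proof.
rewrite trmx_mul -!mulmxA (mulmxA (shear a)) (mulmxA (shear a *m Om)).
rewrite shear_form mulmxDl mulmxDr; congr (_ + _).
by rewrite -scalemxAl -scalemxAr !mulmxA.
Qed.

Lemma shear_sympl a : sympl_map Om (shear a).
Proof. by rewrite /sympl_map shear_form subrr scale0r addr0. Qed.

End Shear.
End Pencil.

(** * Crossings of the bent pencil *)

Section OrthogonalRank.
Variables (R : realFieldType) (n : nat) (D : 'M[R]_n).

Definition definite_on p (A : 'M[R]_(p, n)) :=
  forall x : 'rV[R]_n, (x <= A)%MS -> (x *m D *m x^T) 0 0 = 0 -> x = 0.

(** A vector common to [A] and [B] is [D]-orthogonal to itself, hence zero. *)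
Lemma orthogonal_rankD p q (A : 'M[R]_(p, n)) (B : 'M[R]_(q, n)) :
  definite_on A -> B *m D *m A^T = 0 ->
  \rank (A + B)%MS = (\rank A + \rank B)%N.
Proof.
move=> dA BA; apply: mxrank_disjoint_sum; apply/row_matrixP => i.
rewrite row0; set x := row i _.
have xAB : (x <= A :&: B)%MS by exact: row_sub.
have xA : (x <= A)%MS by rewrite (submx_trans xAB)// capmxSl.
apply: dA => //.
have /submxP[b xb] : (x <= B)%MS by rewrite (submx_trans xAB)// capmxSr.
case/submxP: xA => a xa.
by rewrite {1}xb xa trmx_mul !mulmxA -(mulmxA b) -(mulmxA b) BA mulmx0 mul0mx mxE.
Qed.

(** The definite spaces [A i] are split off one at a time; [B] may meet the kernel of [D] and enters
    only at the base of the induction. *)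
Lemma orthogonal_rank_sum (I : eqType) (s : seq I) p (A : I -> 'M[R]_(p, n))
    q (B : 'M[R]_(q, n)) : uniq s ->
    {in s, forall i, definite_on (A i)} ->
    {in s &, forall i j, i != j -> A i *m D *m (A j)^T = 0} ->
    {in s, forall i, B *m D *m (A i)^T = 0} ->
  (\sum_(i <- s) \rank (A i) + \rank B <= n)%N.
Proof.
move=> us dA AA BA.
have orthD a b c (X : 'M[R]_(a, n)) (Y : 'M[R]_(b, n)) (Z : 'M[R]_(c, n)) :
    X *m D *m Z^T = 0 -> Y *m D *m Z^T = 0 -> (X + Y)%MS *m D *m Z^T = 0.
  move=> XZ YZ; have /sub_addsmxP[[u v] /= ->] := submx_refl (X + Y)%MS.
  by rewrite !mulmxDl -(mulmxA u) -(mulmxA u) -(mulmxA v) -(mulmxA v)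
    XZ YZ !mulmx0 addr0.
(* The second clause is the induction invariant: what is orthogonal to all the generators is
   orthogonal to their span [G]. *)
suff [G [<- _]] : exists G : 'M[R]_n,
    \rank G = (\sum_(i <- s) \rank (A i) + \rank B)%N /\
    forall c (Z : 'M[R]_(c, n)), {in s, forall i, A i *m D *m Z^T = 0} ->
      B *m D *m Z^T = 0 -> G *m D *m Z^T = 0.
  exact: rank_leq_col.
elim: s us dA AA BA => [_ _ _ _|i s IH /= /andP[iNs us] dA AA BA].
  exists <<B>>%MS; split; first by rewrite big_nil genmxE.
  move=> c Z _ BZ; have /submxP[u ->] : (<<B>> <= B)%MS by rewrite genmxE.
  by rewrite -(mulmxA u) -(mulmxA u) BZ mulmx0.
have [|||G [rG GZ]] := IH us.
- by move=> j js; apply: dA; rewrite inE js orbT.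
- by move=> j k js ks; apply: AA; rewrite inE ?js ?ks orbT.
- by move=> j js; apply: BA; rewrite inE js orbT.
exists (A i + G)%MS; split.
  rewrite orthogonal_rankD ?big_cons ?rG ?addnA//.
    by apply: dA; rewrite mem_head.
  apply: GZ => [j js|]; last by apply: BA; rewrite mem_head.
  apply: AA; rewrite ?mem_head ?inE ?js ?orbT//.
  by apply: contraNneq iNs => <-.
move=> c Z AZ BZ; apply: orthD; first by apply: AZ; rewrite mem_head.
by apply: GZ => // j js; apply: AZ; rewrite inE js orbT.
Qed.

End OrthogonalRank.

Section Inertia.
Variables (R : realType) (n : nat).
Implicit Types (q : 'rV[R]_(n + n) -> R) (S : 'M[R]_(n + n)).

Lemma n_plus_le q S c :
  (forall U : 'M[R]_(n + n), (U <= S)%MS -> posdef_on q U -> (\rank U <= c)%N) ->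
  (n_plus q S <= c)%N.
Proof.
move=> H; rewrite /n_plus; apply/bigmax_leqP => k /asboolP[U [US [<- pU]]].
exact: H.
Qed.

Lemma n_plus_eq0 q S : (forall u : 'rV_(n + n), (u <= S)%MS -> q u <= 0) ->
  n_plus q S = 0%N.
Proof.
move=> q0; apply/eqP; rewrite -leqn0; apply: n_plus_le => U US pU.
rewrite leqn0 mxrank_eq0; apply/eqP/row_matrixP => i; rewrite row0.
apply/eqP; apply: contraT => /(pU _ (row_sub _ _)).
by rewrite ltNge q0// (submx_trans (row_sub _ _)).
Qed.

End Inertia.

Section Crossings.
Variables (R : realType) (n : nat) (Om : 'M[R]_(n + n)).
Hypothesis OmS : sympl_form Om.
Variables (X2 X1 : 'M[R]_(n, n + n)) (D : 'M[R]_n).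
Hypothesis aX : adapted Om X2 X1 D.
Variable L0 : 'M[R]_(n + n).
Hypothesis lL0 : lagr Om L0.
Variables (r : nat) (E F : 'M[R]_(r, n + n)).
Hypothesis EL : (E :=: X1 :&: X2 :&: L0)%MS.
Hypothesis EF : E *m Om *m F^T = 1%:M.
Hypothesis F0 : F *m Om *m F^T = 0.

Local Notation P u := (pencil X2 X1 u).

(** [u ^+ 2 - u] vanishes at both ends, leaving the end members unchanged, and is nonzero in
    between, where the shear pushes [E] off [L0]. Its derivative is [-1] at [0] and [1] at [1], so
    the bending adds no positive direction at the start and no negative one at the end. *)
Definition bent_pencil (u : R) := P u *m shear Om F (u ^+ 2 - u).

Local Notation Y := bent_pencil.

Lemma bent_frame u : frame Om (Y u).
Proof.
by apply: frame_sympl => //; [exact: (pencil_frame OmS aX)|exact: shear_sympl].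
Qed.

Lemma bent0 : Y 0 = X2.
Proof.
by rewrite /bent_pencil expr0n subrr shear0 mulmx1 /pencil scale0r addr0.
Qed.

Lemma bent1 : Y 1 = X1.
Proof.
rewrite /bent_pencil expr1n subrr shear0 mulmx1 /pencil scale1r.
by rewrite addrC subrK.
Qed.

(** The coordinates of [E] in [X2] lie in the kernel of [D], where all members agree; hence [E] lies
    in each of them. *)
Lemma pencil_E u : P u *m Om *m E^T = 0.
Proof.
have /submxP[a Ea] : (E <= X2)%MS.
  by rewrite EL (submx_trans (capmxSl _ _))// capmxSr.
have /submxP[b Eb] : (E <= X1)%MS.
  by rewrite EL (submx_trans (capmxSl _ _))// capmxSl.
have [_ [_ X10] _ _ [X21 _]] := aX.
have aD : a *m D = 0.
  rewrite -[D]opprK -X21 mulmxN !mulmxA -Ea Eb.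
  by rewrite -(mulmxA b) -(mulmxA b) X10 mulmx0 oppr0.
have [_ aP] := adapted_ker aX u aD.
rewrite Ea -aP trmx_mul mulmxA.
by case: (pencil_frame OmS aX u) => _ ->; rewrite mul0mx.
Qed.

(* [E] lies in [L0] and in every member of the pencil, so pairing with [E] a
   vector of [L0] lying in a bent member isolates the bending term. *)
Lemma bent_interior q (x : 'M[R]_(q, n)) u :
  0 < u < 1 -> (x *m Y u <= L0)%MS -> x *m P u *m Om *m F^T = 0.
Proof.
move=> /andP[u0 u1] xL.
have FE : F *m Om *m E^T = - 1%:M.
  by rewrite -[LHS]opprK -tr_form// EF trmx1.
have : x *m Y u *m Om *m E^T = 0.
  by apply: (lagr_isotropic lL0) => //; rewrite EL capmxSr.
rewrite /bent_pencil mulmxA mul_shear !mulmxDl -!scalemxAl.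
rewrite -2!(mulmxA x) pencil_E mulmx0 add0r.
rewrite -(mulmxA _ F) -(mulmxA _ (F *m _)) FE mulmxN mulmx1 => /eqP.
rewrite scaler_eq0 oppr_eq0 => /orP[|/eqP//].
by rewrite expr2 -[X in _ - X]mulr1 -mulrBr mulf_eq0 subr_eq0 gt_eqF// lt_eqF.
Qed.

(** Such a vector is unaffected by the bending and lies in [X1 :&: X2 :&: L0], so it is [d *m E];
    pairing with [F] reads off [d], which therefore vanishes. *)
Lemma bent_crossing0 (x : 'rV[R]_n) u : (x *m Y u <= L0)%MS ->
  x *m D = 0 -> x *m P u *m Om *m F^T = 0 -> x = 0.
Proof.
move=> xL xD xF; have [xX1 xP] := adapted_ker aX u xD.
have xY : x *m Y u = x *m X2.
  by rewrite /bent_pencil mulmxA mul_shear xF mul0mx scaler0 addr0.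
have /submxP[d xd] : (x *m X2 <= E)%MS.
  by rewrite EL !sub_capmx -{1}xX1 !submxMl -xY.
have d0 : d = 0.
  by rewrite -[d]mulmx1 -EF !mulmxA -xd -xP.
have [[fX2 _] _ _ _ _] := aX.
by apply: (row_free_inj fX2); rewrite xd d0 !mul0mx.
Qed.

(** Both vectors lie in [L0], so they pair to zero. Once both are written with the same symplectic
    shear, the pairing is also [(u - v) x D y^T]. *)
Lemma bent_orthogonal p q (x : 'M[R]_(p, n)) (y : 'M[R]_(q, n)) u v :
    0 <= u <= 1 -> 0 <= v <= 1 -> u != v ->
    (x *m Y u <= L0)%MS -> (y *m Y v <= L0)%MS ->
  x *m D *m y^T = 0.
Proof.
move=> u01 v01 uv xL yL.
(* At an interior crossing the unbent vector pairs to zero with [F], so every shear fixes it and the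
   parameter [a] is free. *)
have noshear k (z : 'M[R]_(k, n)) w a : 0 < w < 1 -> (z *m Y w <= L0)%MS ->
    z *m Y w = z *m P w *m shear Om F a.
  move=> w01 zL; have zF := bent_interior w01 zL.
  by rewrite /bent_pencil mulmxA !mul_shear zF mul0mx !scaler0 !addr0.
have end0 (w : R) : 0 <= w <= 1 -> ~~ (0 < w < 1) -> w ^+ 2 - w = 0.
  move=> /andP[w0 w1]; rewrite negb_and -!leNgt => /orP[w0'|w1'].
    by have -> : w = 0 by [lra]; rewrite expr0n subrr.
  by have -> : w = 1 by [lra]; rewrite expr1n subrr.
(* An interior crossing borrows the shear parameter of the other one; two end members both have
   parameter [0]. *)
have [a [xa ya]] : exists a, x *m Y u = x *m P u *m shear Om F a /\
    y *m Y v = y *m P v *m shear Om F a.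
  have [ui|/(end0 _ u01) ui] := boolP (0 < u < 1).
    exists (v ^+ 2 - v); split; first exact: noshear.
    by rewrite /bent_pencil mulmxA.
  have [vi|/(end0 _ v01) vi] := boolP (0 < v < 1).
    exists (u ^+ 2 - u); split; last exact: noshear.
    by rewrite /bent_pencil mulmxA.
  by exists 0; rewrite /bent_pencil ui vi !mulmxA.
have : x *m Y u *m Om *m (y *m Y v)^T = 0 by exact: (lagr_isotropic lL0).
rewrite xa ya mul_shear_form// subrr scale0r addr0.
rewrite trmx_mul mulmxA -2!(mulmxA x) (pencil_form OmS aX).
rewrite -scalemxAr -scalemxAl => /eqP.
by rewrite scaler_eq0 subr_eq0 (negbTE uv) => /eqP.
Qed.

Lemma bent_form (x : 'rV[R]_n) u v :
  x *m Y u *m Om *m (x *m Y v)^T = (u - v) *: (x *m D *m x^T)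
    - (u ^+ 2 - u - (v ^+ 2 - v)) *:
      (x *m P u *m Om *m F^T *m (x *m P v *m Om *m F^T)^T).
Proof.
rewrite /bent_pencil !mulmxA mul_shear_form//; congr (_ + _).
  by rewrite trmx_mul mulmxA -2!(mulmxA x) (pencil_form OmS aX)
    -scalemxAr -scalemxAl.
by rewrite -scalerN tr_form// mulmxN opprK.
Qed.

(** Everything is counted in coordinates. The interior crossings [A u] are [D]-definite, [C] stands
    for directions at the end [u = 1], and [G] holds the coordinates of [X1 :&: X2 + X2 :&: L0]: its
    part [K] is in the kernel of [D], its part [A 0] is the crossing at [u = 0]. *)
Lemma bent_crossing_rank (s : seq R) q (C : 'M[R]_(q, n)) :
    uniq s -> {in s, forall u, 0 < u < 1} ->
    (C *m X1 <= L0)%MS -> definite_on D C ->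
  (\sum_(u <- s) \rank (Y u :&: L0)%MS + \rank C
    + \rank (X1 :&: X2 + X2 :&: L0)%MS <= n)%N.
Proof.
move=> us s01 CL dC.
pose A u := (Y u :&: L0)%MS *m pinvmx (Y u).
have AY u : A u *m Y u = (Y u :&: L0)%MS by rewrite mulmxKpV ?capmxSl.
have AL u : (A u *m Y u <= L0)%MS by rewrite AY capmxSr.
have rA u : (\rank (Y u :&: L0)%MS <= \rank (A u))%N by rewrite -AY mxrankM_maxl.
pose K := (X1 :&: X2)%MS *m pinvmx X2.
have KX2 : K *m X2 = (X1 :&: X2)%MS by rewrite mulmxKpV ?capmxSr.
pose G := (K + A 0)%MS.
have rG : (\rank (X1 :&: X2 + X2 :&: L0)%MS <= \rank G)%N.
  apply: leq_trans (mxrankM_maxl G X2); apply: mxrankS.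
  have A0X2 : A 0 *m X2 = (X2 :&: L0)%MS by have := AY 0; rewrite bent0.
  by rewrite addsmxMr KX2 A0X2.
have KD : K *m D = 0.
  have /submxP[b Eb] : (K *m X2 <= X1)%MS by rewrite KX2 capmxSl.
  have [_ [_ X10] _ _ [X21 _]] := aX.
  rewrite -[D]opprK -X21 mulmxN !mulmxA Eb.
  by rewrite -(mulmxA b) -(mulmxA b) X10 mulmx0 oppr0.
have GD p (Z : 'M[R]_(p, n)) v : 0 < v <= 1 -> (Z *m Y v <= L0)%MS ->
    G *m D *m Z^T = 0.
  move=> /andP[v0 v1] ZL; have /sub_addsmxP[[a b] /= ->] := submx_refl G.
  rewrite !mulmxDl -(mulmxA a) KD mulmx0 mul0mx add0r -(mulmxA b) -(mulmxA b).
  rewrite (@bent_orthogonal _ _ (A 0) Z 0 v) ?mulmx0 ?lexx ?ler01//.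
  - by rewrite (ltW v0) v1.
  - by rewrite lt_eqF.
have CY : (C *m Y 1 <= L0)%MS by rewrite bent1.
have rCG : \rank (C + G)%MS = (\rank C + \rank G)%N.
  by apply: (orthogonal_rankD dC); apply: GD CY; rewrite ltr01 lexx.
have {}s01' u : u \in s -> 0 <= u <= 1.
  by move=> /s01/andP[u0 u1]; rewrite !ltW.
have := @orthogonal_rank_sum R n D _ s _ A _ (C + G)%MS us.
rewrite rCG => sumA; rewrite -addnA.
apply: leq_trans (sumA _ _ _).
- by apply: leq_add; [apply: leq_sum => u _|rewrite leq_add2l].
- move=> u us' x /submxP[b xb] /(adapted_quad_eq0 aX) xD.
  have xL : (x *m Y u <= L0)%MS.
    by rewrite xb -mulmxA (submx_trans (submxMl _ _)).
  by apply: (bent_crossing0 xL xD); apply: bent_interior xL; exact: s01.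
- by move=> u v us' vs uv; apply: (bent_orthogonal _ _ uv); rewrite ?s01'.
- move=> u us'; have /andP[u0 u1] := s01 _ us'.
  have /sub_addsmxP[[a b] /= ->] := submx_refl (C + G)%MS.
  rewrite !mulmxDl -(mulmxA a) -(mulmxA a) -(mulmxA b) -(mulmxA b).
  rewrite (@bent_orthogonal _ _ C (A u) 1 u) ?ler01 ?lexx ?s01' ?gt_eqF//.
  by rewrite (GD _ _ u) ?u0 ?ltW// !mulmx0 addr0.
Qed.

End Crossings.

(** * Limits and derivatives of row projectors *)

Section MatrixLimits.
Variables (R : realType) (T : Type) (F : set_system T).
Hypothesis FF : Filter F.

Lemma cvg_mxP p q (M : T -> 'M[R]_(p, q)) (M0 : 'M[R]_(p, q)) :
  M x @[x --> F] --> M0 <->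
  forall i j, (M x i j : R) @[x --> F] --> (M0 i j : R).
Proof.
split=> [MM0 i j|MM0].
  exact: (cvg_comp _ _ MM0 (@coord_continuous _ _ _ i j M0)).
apply/cvgrPdist_le => e e0; near=> x.
rewrite /Num.Def.normr /= mx_normrE (bigmax_le _ (ltW e0))//= => i _.
rewrite !mxE; move: i; near: x; apply: filter_forall => -[i j] /=.
by move/cvgrPdist_le : (MM0 i j); apply.
Unshelve. all: by end_near. Qed.

Lemma cvg_mulmx p q r (A : T -> 'M[R]_(p, q)) (A0 : 'M[R]_(p, q))
    (B : T -> 'M[R]_(q, r)) (B0 : 'M[R]_(q, r)) :
  A x @[x --> F] --> A0 -> B x @[x --> F] --> B0 ->
  A x *m B x @[x --> F] --> A0 *m B0.
Proof.
move=> /cvg_mxP AA0 /cvg_mxP BB0; apply/cvg_mxP => i j.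
rewrite mxE; under eq_fun do rewrite mxE.
apply: cvg_big => [|k _]; first exact: add_continuous.
exact: cvgM.
Qed.

Lemma cvg_trmx p q (A : T -> 'M[R]_(p, q)) (A0 : 'M[R]_(p, q)) :
  A x @[x --> F] --> A0 -> (A x)^T @[x --> F] --> A0^T.
Proof.
move=> /cvg_mxP AA0; apply/cvg_mxP => i j.
rewrite mxE; under eq_fun do rewrite mxE.
exact: AA0.
Qed.

Lemma cvg_det p (A : T -> 'M[R]_p) (A0 : 'M[R]_p) :
  A x @[x --> F] --> A0 -> \det (A x) @[x --> F] --> \det A0.
Proof.
move=> /cvg_mxP AA0; rewrite /determinant.
apply: cvg_big => [|s _]; first exact: add_continuous.
apply: cvgM; first exact: cvg_cst.
by apply: cvg_big => [|i _]; [exact: mul_continuous|exact: AA0].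
Qed.

Lemma cvg_adj p (A : T -> 'M[R]_p) (A0 : 'M[R]_p) :
  A x @[x --> F] --> A0 -> \adj (A x) @[x --> F] --> \adj A0.
Proof.
move=> /cvg_mxP AA0; apply/cvg_mxP => i j.
rewrite mxE; under eq_fun do rewrite mxE.
apply: cvgM; first exact: cvg_cst.
apply: cvg_det; apply/cvg_mxP => k l.
rewrite !mxE; under eq_fun do rewrite !mxE.
exact: AA0.
Qed.

Lemma cvg_rproj p q (X : T -> 'M[R]_(p, q)) (X0 : 'M[R]_(p, q)) :
  row_free X0 ->
  X x @[x --> F] --> X0 -> rproj (X x) @[x --> F] --> rproj X0.
Proof.
move=> fX0 XX0; rewrite /rproj.
have GG : X x *m (X x)^T @[x --> F] --> X0 *m X0^T.
  by apply: cvg_mulmx => //; exact: cvg_trmx.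
apply: cvgZ; last first.
  by apply: cvg_mulmx => //; apply: cvg_mulmx; [exact: cvg_trmx|exact: cvg_adj].
apply: cvgV; last exact: cvg_det.
by rewrite -unitfE -unitmxE gram_unitmx.
Qed.

End MatrixLimits.

Section PolynomialFrames.
Variables (R : realType).

Definition evmx p q (t : R) (X : 'M[{poly R}]_(p, q)) : 'M[R]_(p, q) :=
  map_mx (horner_eval t) X.

Lemma evmxC p q t (A : 'M[R]_(p, q)) : evmx t (map_mx polyC A) = A.
Proof. by apply/matrixP => i j; rewrite !mxE /horner_eval hornerC. Qed.

Lemma evmxM p q r t (A : 'M[{poly R}]_(p, q)) (B : 'M[{poly R}]_(q, r)) :
  evmx t (A *m B) = evmx t A *m evmx t B.
Proof. exact: map_mxM. Qed.

Lemma evmx_tr p q t (A : 'M[{poly R}]_(p, q)) : evmx t A^T = (evmx t A)^T.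
Proof. by rewrite /evmx map_trmx. Qed.

Lemma evmx_adj p t (A : 'M[{poly R}]_p) : evmx t (\adj A) = \adj (evmx t A).
Proof. exact: map_mx_adj. Qed.

Lemma evmx_det p t (A : 'M[{poly R}]_p) : (\det A).[t] = \det (evmx t A).
Proof. by rewrite /evmx det_map_mx. Qed.

Lemma is_derive_horner (p : {poly R}) (t : R) :
  is_derive t (1 : R) (horner p) (p^`()).[t].
Proof.
have dp : derivable (horner p) t 1 by exact: derivable_horner.
by apply: (DeriveDef dp); rewrite -derive1E -derivE.
Qed.

Lemma is_derive_horner_div (p q : {poly R}) (t : R) : q.[t] != 0 ->
  is_derive t (1 : R) (fun t => p.[t] / q.[t])
    ((p^`() * q - p * q^`()).[t] / (q ^+ 2).[t]).
Proof.
move=> qt; have dq := is_deriveV qt (is_derive_horner q t).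
apply: is_derive_eq (is_deriveM (is_derive_horner p t) dq) _.
rewrite !hornerE /GRing.scale /=.
by field.
Qed.

Lemma rproj_evmxE p q (X : 'M[{poly R}]_(p, q)) t i j :
  rproj (evmx t X) i j =
    ((X^T *m \adj (X *m X^T) *m X) i j).[t] / (\det (X *m X^T)).[t].
Proof.
have -> : rproj (evmx t X) = (\det (evmx t (X *m X^T)))^-1 *:
    evmx t (X^T *m \adj (X *m X^T) *m X).
  by rewrite !(evmxM, evmx_adj, evmx_tr).
by rewrite evmx_det !mxE mulrC.
Qed.

(** Each entry is a quotient of polynomials in [t] whose denominator, the Gram determinant, never
    vanishes. This supplies the regularity that the crossing formula asks for. *)
Lemma rproj_evmx_C1 p q (X : 'M[{poly R}]_(p, q)) :
  (forall t, row_free (evmx t X)) ->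
  (forall t, derivable (fun t => rproj (evmx t X)) t 1) /\
  continuous ('D_1 (fun t => rproj (evmx t X))).
Proof.
move=> fX.
have q0 t : (\det (X *m X^T)).[t] != 0.
  have := gram_unitmx (fX t); rewrite unitmxE unitfE.
  by rewrite evmx_det evmxM evmx_tr.
have dE t i j := is_derive_horner_div ((X^T *m \adj (X *m X^T) *m X) i j) (q0 t).
have eE i j : (fun t => rproj (evmx t X) i j) = (fun t =>
    ((X^T *m \adj (X *m X^T) *m X) i j).[t] / (\det (X *m X^T)).[t]).
  by apply/funext => t; rewrite rproj_evmxE.
have dX t : derivable (fun t => rproj (evmx t X)) t 1.
  by apply/derivable_mxP => i j; rewrite eE; have [] := dE t i j.
split=> // t; apply/(cvg_mxP (nbhs_filter t)) => i j.
have DE s : 'D_1 (fun t => rproj (evmx t X)) s i j =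
    'D_1 (fun t => rproj (evmx t X) i j) s by rewrite derive_mx// mxE.
rewrite DE; under eq_fun do rewrite DE.
rewrite eE; rewrite (@derive_val _ _ _ _ _ _ _ (dE t i j)).
have -> : 'D_1 (fun t => ((X^T *m \adj (X *m X^T) *m X) i j).[t]
    / (\det (X *m X^T)).[t]) = (fun s => 
  (((X^T *m \adj (X *m X^T) *m X) i j)^`() * \det (X *m X^T) -
     (X^T *m \adj (X *m X^T) *m X) i j * (\det (X *m X^T))^`()).[s] /
    (\det (X *m X^T) ^+ 2).[s]).
  by apply/funext => s; rewrite (@derive_val _ _ _ _ _ _ _ (dE s i j)).
apply: cvgM; first exact: continuous_horner.
by apply: cvgV; [rewrite horner_exp expf_neq0|exact: continuous_horner].
Qed.

End PolynomialFrames.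

(** * The crossing form of a polynomial path of frames *)

Section CrossingForm.
Variables (R : realType) (n : nat) (Om : 'M[R]_(n + n)).
Hypothesis OmS : sympl_form Om.

(** A row killed by the pairing yields a vector of [X] orthogonal to the Lagrangian [W], hence in
    [W] by maximality; conversely a common vector is killed by the pairing. *)
Lemma transversal_unitmx X W (L M : 'M[R]_(n + n)) :
    frame Om X -> frame Om W -> (L :=: X)%MS -> (M :=: W)%MS ->
  (M :&: L == (0 : 'M[R]_(n + n)))%MS = (X *m Om *m W^T \in unitmx).
Proof.
move=> fX fW LX MW; apply/idP/idP => [|u].
  move/eqmx0P => ML.
  rewrite -row_free_unit -kermx_eq0; apply/eqP/row_matrixP => i.
  rewrite row0; set y := row i _.
  have /sub_kermxP y0 : (y <= kermx (X *m Om *m W^T))%MS by exact: row_sub.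
  have yW : (y *m X <= W)%MS.
    by apply: (frame_max OmS fW); rewrite -y0 !mulmxA.
  have : (y *m X <= M :&: L)%MS by rewrite sub_capmx MW LX yW submxMl.
  rewrite ML submx0 => /eqP yX.
  by apply: (row_free_inj fX.1); rewrite yX mul0mx.
apply/eqmx0P/row_matrixP => i; rewrite row0; set v := row i _.
have : (v <= M :&: L)%MS by exact: row_sub.
rewrite sub_capmx MW LX => /andP[/submxP[w vw] /submxP[x vx]].
have : x *m (X *m Om *m W^T) = 0.
  rewrite !mulmxA -vx vw -2!(mulmxA w).
  by case: fW => _ ->; rewrite mulmx0.
move=> /(congr1 (mulmx^~ (invmx (X *m Om *m W^T)))).
by rewrite mulmxK// mul0mx vx => ->; rewrite mul0mx.
Qed.

(** With [w] the projection of [v] to [W], [omega v v = 0] lets [v - w] replace [- w]. The vector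
    [v - w] lies in [L], and its coordinates in [X'] are found by pairing with [WF], which kills
    [w]. *)
Lemma crossing_form_near (X X' : 'M[R]_(n, n + n)) (W L : 'M[R]_(n + n))
    (WF : 'M[R]_(n, n + n)) (x : 'rV[R]_n) :
    frame Om X -> frame Om X' -> frame Om WF -> (W :=: WF)%MS -> (L :=: X')%MS ->
    X' *m Om *m WF^T \in unitmx ->
  omega Om (x *m X) (- (x *m X *m proj_mx W L)) =
  omega Om (x *m X)
    (x *m (X *m Om *m WF^T) *m invmx (X' *m Om *m WF^T) *m X').
Proof.
move=> fX fX' fW WW LX u.
set v := x *m X; set w := v *m proj_mx W L.
have WL0 : (W :&: L)%MS = 0.
  by apply/eqmx0P; rewrite (transversal_unitmx fX' fW LX WW).
have full : (v <= W + L)%MS.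
  apply: submx_full; rewrite /row_full mxrank_disjoint_sum// WW LX.
  by rewrite (eqP fW.1) (eqP fX'.1).
have /submxP[y vy] : (v - w <= X')%MS by rewrite -LX proj_mx_compl_sub.
have wW : w *m Om *m WF^T = 0.
  have /submxP[a ->] : (w <= WF)%MS by rewrite -WW proj_mx_sub.
  by rewrite -2!(mulmxA a); case: fW => _ ->; rewrite mulmx0.
have -> : x *m (X *m Om *m WF^T) *m invmx (X' *m Om *m WF^T) = y.
  rewrite !mulmxA -/v.
  have -> : v *m Om *m WF^T = y *m (X' *m Om *m WF^T).
    by rewrite !mulmxA -vy !mulmxBl wW subr0.
  by rewrite mulmxK.
have vv : v *m Om *m v^T = 0.
  rewrite /v trmx_mul mulmxA -2!(mulmxA x).
  by case: fX => _ ->; rewrite mulmx0 mul0mx.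
by rewrite -vy /omega !linearD /= !linearN /= vv add0r.
Qed.

(** Removes [W] from the crossing form. Near [t0] the function is [P / Q] with [P] the sum of the
    [g_j h_j]; [g] vanishes at [t0] and [h] equals [Q x] there, so only the derivative of [g]
    survives. *)
Lemma crossing_form_poly (X : 'M[{poly R}]_(n, n + n)) W t0 (x : 'rV[R]_n) :
    (forall t, frame Om (evmx t X)) -> lagr Om W ->
    (W :&: rproj (evmx t0 X) == (0 : 'M[R]_(n + n)))%MS ->
  crossing_form Om (fun t => rproj (evmx t X)) t0 W (x *m evmx t0 X) =
  derive1 (fun t => omega Om (x *m evmx t0 X) (x *m evmx t X)) t0.
Proof.
move=> fX lW; have [WF [fW WW]] := lagr_frame lW.
rewrite (transversal_unitmx (fX t0) fW _ WW); last exact: rproj_eqmx (fX t0).1.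
move=> u0; set v := x *m evmx t0 X.
pose M := X *m map_mx polyC Om *m (map_mx polyC WF)^T.
have evM t : evmx t M = evmx t X *m Om *m WF^T.
  by rewrite !evmxM evmx_tr !evmxC.
pose z := x *m (evmx t0 X *m Om *m WF^T).
pose g := map_mx polyC (v *m Om) *m X^T.
pose h := map_mx polyC z *m \adj M.
pose Q := \det M.
pose P := (g *m h^T) 0 0.
have evE p q (A : 'M[{poly R}]_(p, q)) t i j : (A i j).[t] = evmx t A i j.
  by rewrite mxE.
have evg t j : (g 0 j).[t] = (v *m Om *m (evmx t X)^T) 0 j.
  by rewrite evE evmxM evmxC evmx_tr.
have evh t j : (h 0 j).[t] = (z *m \adj (evmx t M)) 0 j.
  by rewrite evE evmxM evmxC evmx_adj.
have evQ t : Q.[t] = \det (evmx t M) by exact: evmx_det.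
have Q0 : Q.[t0] != 0 by rewrite evQ -unitfE -unitmxE evM.
have nearQ : \forall t \near t0, Q.[t] != 0.
  have Qc : horner Q t @[t --> t0] --> horner Q t0 by exact: continuous_horner.
  exact: (cvgr_neq0 _ Qc Q0).
have fE t : Q.[t] != 0 ->
  omega Om v (- (v *m proj_mx W (rproj (evmx t X)))) = P.[t] / Q.[t].
  move=> Qt; have uM : evmx t X *m Om *m WF^T \in unitmx.
    by rewrite unitmxE unitfE -evM -evQ.
  rewrite (crossing_form_near _ (fX t0) (fX t) fW WW (rproj_eqmx (fX t).1))//.
  rewrite /invmx uM -/z -scalemxAr -scalemxAl /omega linearZ /= -scalemxAr mxE.
  rewrite -evM -evQ mulrC; congr (_ / _).
  rewrite trmx_mul mulmxA mxE /P mxE horner_sum; apply: eq_bigr => j _.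
  by rewrite hornerM evg; congr (_ * _); rewrite [LHS]mxE [in RHS]mxE evh.
have g0 j : (g 0 j).[t0] = 0.
  rewrite evg /v -2!(mulmxA x); case: (fX t0) => _ ->.
  by rewrite mulmx0 mxE.
have h0 j : (h 0 j).[t0] = Q.[t0] * x 0 j.
  by rewrite evh /z -evM -mulmxA mul_mx_adj mul_mx_scalar mxE -evQ.
have PE : P = \sum_j g 0 j * h 0 j.
  by rewrite /P mxE; apply: eq_bigr => j _; rewrite [h^T _ _]mxE.
have P0 : P.[t0] = 0.
  by rewrite PE horner_sum big1// => j _; rewrite hornerM g0 mul0r.
have P'0 : P^`().[t0] = Q.[t0] * \sum_j (g 0 j)^`().[t0] * x 0 j.
  rewrite PE raddf_sum /= horner_sum mulr_sumr; apply: eq_bigr => j _.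
  by rewrite derivM hornerD !hornerM g0 mul0r addr0 h0 mulrCA.
have -> : (fun t => omega Om v (x *m evmx t X)) =
    horner (\sum_j g 0 j * (x 0 j)%:P).
  apply/funext => t; rewrite /omega trmx_mul mulmxA mxE horner_sum.
  by apply: eq_bigr => j _; rewrite hornerM hornerC evg [x^T _ _]mxE.
rewrite /crossing_form !derive1E.
have Pd : is_derive t0 (1 : R)
    (fun t => omega Om v (- (v *m proj_mx W (rproj (evmx t X)))))
    ((P^`() * Q - P * Q^`()).[t0] / (Q ^+ 2).[t0]).
  apply: near_eq_is_derive (is_derive_horner_div P Q0).
  by near=> t; rewrite fE//; near: t.
rewrite (@derive_val _ _ _ _ _ _ _ Pd).
rewrite (@derive_val _ _ _ _ _ _ _ (is_derive_horner _ _)).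
rewrite hornerD hornerN !hornerM P0 mul0r subr0 P'0 raddf_sum /=.
set S := \sum_j _; have -> : (\sum_i (g 0 i * (x 0 i)%:P)^`()).[t0] = S.
  rewrite horner_sum; apply: eq_bigr => j _.
  by rewrite derivM derivC mulr0 addr0 hornerM hornerC.
by field.
Unshelve. all: by end_near. Qed.

End CrossingForm.

(** * Homotopies of frames *)

(** A list of maximal length contains every point satisfying [P]. This serves to enumerate the
    crossing instants. *)
Lemma bounded_uniq_list (T : eqType) (P : T -> Prop) N :
  (forall s : seq T, uniq s -> (forall x, x \in s -> P x) -> (size s <= N)%N) ->
  exists2 s : seq T, uniq s & forall x, x \in s <-> P x.
Proof.
move=> sN.
pose Q k := `[< exists s : seq T,
  [/\ uniq s, forall x, x \in s -> P x & size s = k] >].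
have Q0 : exists k, Q k by exists 0%N; apply/asboolP; exists [::].
have QN k : Q k -> (k <= N)%N by move=> /asboolP[s [us sP <-]]; exact: sN.
case: (ex_maxnP Q0 QN) => k /asboolP[s [us sP sk]] kmax.
exists s => // x; split; first exact: sP.
move=> Px; apply: contraT => xs.
have /kmax : Q k.+1.
  apply/asboolP; exists (x :: s); rewrite /= xs us sk; split=> // y.
  by rewrite inE => /predU1P[->//|/sP].
by rewrite ltnn.
Qed.

Lemma within_continuous_comp (T U V : topologicalType) (A : set T) (B : set U)
    (f : T -> U) (g : U -> V) :
    (forall x, A x -> B (f x)) -> {within A, continuous f} ->
    {within B, continuous g} -> {within A, continuous (g \o f)}.
Proof.
move=> AB /subspace_continuousP cf /subspace_continuousP cg.
apply/subspace_continuousP => x Ax.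
apply: cvg_comp (cg _ (AB _ Ax)) => S BS.
have fS : within A (nbhs x) (f @^-1` (fun y => B y -> S y)) := cf x Ax _ BS.
suff : within A (nbhs x) (f @^-1` S) by [].
by apply: filterS2 fS (withinT A (nbhs_filter x)) => z BSz /AB/BSz.
Qed.

Lemma within_slice (R : realType) (V : topologicalType) (f : R -> R -> V)
    (a b s : R) : 0 <= s <= 1 ->
  {within [set p : R * R | 0 <= p.1 <= 1 /\ a <= p.2 <= b],
     continuous (fun p : R * R => f p.1 p.2)} ->
  {within [set t | a <= t <= b], continuous (f s)}.
Proof.
move=> s01 cf; have cs : {within [set t | a <= t <= b], continuous (pair s)}.
  apply: continuous_subspaceT => t.
  apply: (@cvg_pair _ _ _ (nbhs t) (nbhs s) (nbhs t) _ _ _ (fun=> s) id).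
    exact: cvg_cst.
  exact: cvg_id.
by apply: (within_continuous_comp _ cs cf).
Qed.

Section Index.
Variables (R : realType) (n : nat) (Om : 'M[R]_(n + n)).
Hypothesis OmS : sympl_form Om.
Variable iota : 'M[R]_(n + n) -> (R -> 'M[R]_(n + n)) -> R -> R -> int.
Hypothesis CLM : is_CLM Om iota.
Variable L0 : 'M[R]_(n + n).
Hypothesis lL0 : lagr Om L0.

Lemma lag_path_frame (X : R -> 'M[R]_(n, n + n)) (l : R -> 'M[R]_(n + n)) a b :
    (forall t, a <= t <= b -> frame Om (X t)) ->
    {within [set t | a <= t <= b], continuous X} ->
    (forall t, a <= t <= b -> l t = rproj (X t)) ->
  lag_path Om l a b.
Proof.
move=> fX cX lX; split=> [t abt|].
  by rewrite lX//; exact: frame_lagr (fX t abt).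
apply/subspace_continuousP => t abt; rewrite /from_subspace lX//.
have XX := (subspace_continuousP _ _).1 cX t abt.
apply: cvg_trans (cvg_rproj _ (fX t abt).1 XX).
by apply: fmap_within_eq => s; rewrite inE => abs; exact: lX.
Qed.

(** Homotopy invariance read on frames. At the ends only the spanned subspaces are held fixed; the
    frames themselves may move. *)
Lemma iota_homotopy (X : R -> R -> 'M[R]_(n, n + n)) l0 l1 a b : a <= b ->
    (forall s t, 0 <= s <= 1 -> a <= t <= b -> frame Om (X s t)) ->
    {within [set p : R * R | 0 <= p.1 <= 1 /\ a <= p.2 <= b],
       continuous (fun p : R * R => X p.1 p.2)} ->
    (forall t, a <= t <= b -> l0 t = rproj (X 0 t) /\ l1 t = rproj (X 1 t)) ->
    (forall s, 0 <= s <= 1 ->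
       rproj (X s a) = rproj (X 0 a) /\ rproj (X s b) = rproj (X 0 b)) ->
  iota L0 l0 a b = iota L0 l1 a b.
Proof.
move=> ab fX cX lX eX; case: CLM => hom _.
have slice s s01 := within_slice (s := s) s01 cX.
apply: (hom L0 l0 l1 (fun s t => rproj (X s t)) a b lL0 ab).
- apply: (@lag_path_frame (X 0)) => [t|//|t /lX[]//]; last first.
    by apply: slice; rewrite lexx ler01.
  by apply: fX; rewrite lexx ler01.
- apply: (@lag_path_frame (X 1)) => [t|//|t /lX[]//]; last first.
    by apply: slice; rewrite lexx ler01.
  by apply: fX; rewrite lexx ler01.
- by move=> s t s01 abt; exact: frame_lagr (fX s t s01 abt).
- apply/subspace_continuousP => -[s t] [/= s01 abt].
  have XX := (subspace_continuousP _ _).1 cX (s, t) (conj s01 abt).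
  exact: (cvg_rproj _ (fX s t s01 abt).1 XX).
- by move=> t /lX[-> ->].
- move=> s s01; have [-> ->] := eX s s01.
  by split; [case: (lX a); rewrite ?lexx|case: (lX b); rewrite ?lexx ?andbT].
Qed.
(** The constant homotopy shows that values outside [[a, b]] do not affect the index. *)
Lemma iota_eq (X : R -> 'M[R]_(n, n + n)) l l' a b : a <= b ->
    (forall t, a <= t <= b -> frame Om (X t)) ->
    {within [set t | a <= t <= b], continuous X} ->
    (forall t, a <= t <= b -> l t = rproj (X t) /\ l' t = rproj (X t)) ->
  iota L0 l a b = iota L0 l' a b.
Proof.
move=> ab fX cX lX.
apply: (iota_homotopy (X := fun=> X)) => // [s t _|]; first exact: fX.
have csnd : {within [set p : R * R | 0 <= p.1 <= 1 /\ a <= p.2 <= b],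
    continuous (@snd R R)} by apply: continuous_subspaceT => p; exact: cvg_snd.
by apply: (within_continuous_comp _ csnd cX) => p [].
Qed.

End Index.

(** * The index of a pencil *)

Section PencilIndex.
Variables (R : realType) (n : nat) (Om : 'M[R]_(n + n)).
Hypothesis OmS : sympl_form Om.

(** The isotropic dual of a Lagrangian frame pairs with it by the identity, hence spans a
    transversal Lagrangian. *)
Lemma lagr_transversal X : frame Om X ->
  exists W, lagr Om W /\ (W :&: rproj X == (0 : 'M[R]_(n + n)))%MS.
Proof.
move=> fX; have [F [XF F0]] := isotropic_dual OmS.1 OmS.2 fX.1 fX.2.
have fF : frame Om F.
  split=> //; apply/row_freeP; exists (- (Om *m X^T)).
  by rewrite mulmxN mulmxA -tr_form// XF trmx1.
exists (rproj F); split; first exact: frame_lagr.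
rewrite (transversal_unitmx OmS fX fF) ?XF ?unitmx1//.
  exact: (rproj_eqmx fX.1).
exact: (rproj_eqmx fF.1).
Qed.

Section Limits.
Variables (T : Type) (G : set_system T).
Hypothesis FG : Filter G.

Lemma cvg_pencil (X2 X1 : 'M[R]_(n, n + n)) (u : T -> R) (u0 : R) :
  u x @[x --> G] --> u0 -> pencil X2 X1 (u x) @[x --> G] --> pencil X2 X1 u0.
Proof. by move=> uu0; apply: cvgD; [exact: cvg_cst|exact: cvgZr_tmp]. Qed.

Lemma cvg_shear r (F : 'M[R]_(r, n + n)) (u : T -> R) (u0 : R) :
  u x @[x --> G] --> u0 -> shear Om F (u x) @[x --> G] --> shear Om F u0.
Proof. by move=> uu0; apply: cvgD; [exact: cvg_cst|exact: cvgZr_tmp]. Qed.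

End Limits.

Definition bent_poly r (X2 X1 : 'M[R]_(n, n + n)) (F : 'M[R]_(r, n + n)) (a : R) :
    'M[{poly R}]_(n, n + n) :=
  let u := 'X - a%:P in
  (map_mx polyC X2 + u *: map_mx polyC (X1 - X2)) *m
  (map_mx polyC 1%:M + (u ^+ 2 - u) *: map_mx polyC (Om *m F^T *m F)).

Lemma bent_polyE r (X2 X1 : 'M[R]_(n, n + n)) (F : 'M[R]_(r, n + n)) a t :
  evmx t (bent_poly X2 X1 F a) = bent_pencil Om X2 X1 F (t - a).
Proof.
have evZ p q (v : {poly R}) (A B : 'M[R]_(p, q)) :
    evmx t (map_mx polyC A + v *: map_mx polyC B) = A + v.[t] *: B.
  by apply/matrixP => i j; rewrite !mxE /horner_eval !hornerE.
rewrite evmxM !evZ /bent_pencil /pencil /shear.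
by rewrite !hornerE.
Qed.

Section Bent.
Variables (X2 X1 : 'M[R]_(n, n + n)) (D : 'M[R]_n).
Hypothesis aX : adapted Om X2 X1 D.
Variable L0 : 'M[R]_(n + n).
Hypothesis lL0 : lagr Om L0.
Variables (r : nat) (E F : 'M[R]_(r, n + n)).
Hypothesis EL : (E :=: X1 :&: X2 :&: L0)%MS.
Hypothesis EF : E *m Om *m F^T = 1%:M.
Hypothesis F0 : F *m Om *m F^T = 0.
Variable a : R.

Local Notation Y := (bent_pencil Om X2 X1 F).
Local Notation l := (fun t => rproj (Y (t - a))).

Let YE : (fun t => rproj (evmx t (bent_poly X2 X1 F a))) = l.
Proof. by apply/funext => t; rewrite bent_polyE. Qed.

Let fY t : frame Om (Y t). Proof. exact: (bent_frame OmS aX F0). Qed.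

(** The derivative at [v = u] of the pairing in [bent_form]; the factor [2 * u - 1] is the
    derivative of [u ^+ 2 - u]. *)
Definition bent_quad (u : R) (x : 'rV[R]_n) : R :=
  - (x *m D *m x^T) 0 0 + (2 * u - 1) *
    (x *m pencil X2 X1 u *m Om *m F^T *m
      (x *m pencil X2 X1 u *m Om *m F^T)^T) 0 0.

Lemma bent_crossing_form W t (x : 'rV[R]_n) :
    lagr Om W -> (W :&: l t == (0 : 'M[R]_(n + n)))%MS ->
  crossing_form Om l t W (x *m Y (t - a)) = bent_quad (t - a) x.
Proof.
move=> lW Wl; rewrite -YE -bent_polyE crossing_form_poly//; last 2 first.
- by move=> s; rewrite bent_polyE.
- by rewrite bent_polyE.
set u := t - a.
pose k := x *m pencil X2 X1 u *m Om *m F^T.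
pose c0 := (k *m (x *m X2 *m Om *m F^T)^T) 0 0.
pose c1 := (k *m (x *m (X1 - X2) *m Om *m F^T)^T) 0 0.
have kE v : (k *m (x *m pencil X2 X1 v *m Om *m F^T)^T) 0 0 = c0 + v * c1.
  rewrite /pencil mulmxDr -scalemxAr !mulmxDl -!scalemxAl.
  set A := _ *m F^T; set B := _ *m F^T.
  have -> : (A + v *: B)^T = A^T + v *: B^T.
    by apply/matrixP => i j; rewrite !mxE.
  by rewrite mulmxDr -scalemxAr mxE [X in _ + X]mxE.
pose d := (x *m D *m x^T) 0 0.
pose p : {poly R} := (u%:P - ('X - a%:P)) * d%:P -
  ((u ^+ 2 - u)%:P - (('X - a%:P) ^+ 2 - ('X - a%:P))) *
  (c0%:P + ('X - a%:P) * c1%:P).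
have -> : (fun s => omega Om (x *m evmx t (bent_poly X2 X1 F a))
    (x *m evmx s (bent_poly X2 X1 F a))) = horner p.
  apply/funext => s; rewrite /omega !bent_polyE -/u (bent_form OmS aX F0).
  rewrite -/k; set v := s - a.
  have ZE (b c : R) (A B : 'M[R]_1) :
      (b *: A - c *: B) 0 0 = b * A 0 0 - c * B 0 0 by rewrite !mxE.
  by rewrite ZE kE -/d /p !hornerE.
rewrite -derivE /bent_quad -/k kE -/d /p.
rewrite !derivCE !hornerE -/u /=.
by rewrite /u; ring.
Qed.

Lemma bent_quad_polar u (x y : 'rV[R]_n) :
  bent_quad u (x + y) - bent_quad u x - bent_quad u y =
  2 * (- (x *m D *m y^T) 0 0 + (2 * u - 1) *
    (x *m pencil X2 X1 u *m Om *m F^T *m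
      (y *m pencil X2 X1 u *m Om *m F^T)^T) 0 0).
Proof.
have sym1 (A : 'M[R]_1) : A 0 0 = A^T 0 0 by rewrite mxE.
have [_ _ DT _ _] := aX.
have yx : (y *m D *m x^T) 0 0 = (x *m D *m y^T) 0 0.
  by rewrite sym1 !trmx_mul trmxK DT mulmxA.
rewrite /bent_quad !mulmxDl.
set k := x *m pencil _ _ _ *m Om *m F^T; set h := y *m pencil _ _ _ *m Om *m F^T.
have hk : (h *m k^T) 0 0 = (k *m h^T) 0 0 by rewrite sym1 trmx_mul trmxK.
have trD p q (A B : 'M[R]_(p, q)) : (A + B)^T = A^T + B^T by rewrite linearD.
have addE (A B : 'M[R]_1) : (A + B) 0 0 = A 0 0 + B 0 0 by rewrite mxE.
rewrite !trD !mulmxDr !addE hk yx; ring.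
Qed.

(** At an interior crossing [k = 0] and only the [D] term is left; at [u = 0] the coefficient
    [2 * u - 1 = -1] makes both terms nonpositive. When they vanish, [bent_crossing0] applies. *)
Lemma bent_quad_le0 u (x : 'rV[R]_n) : 0 <= u < 1 -> (x *m Y u <= L0)%MS ->
  bent_quad u x <= 0 /\ (bent_quad u x = 0 -> x = 0).
Proof.
move=> /andP[u0 u1] xL; have d0 := adapted_quad_ge0 aX x.
rewrite /bent_quad; set k := x *m pencil _ _ _ *m Om *m F^T.
have k0 := dotrv_ge0 k.
have [ui|u_le0] := ltP 0 u.
  have kz : k = 0 by apply: (bent_interior OmS aX lL0 EL EF _ xL); rewrite ui u1.
  rewrite kz mul0mx [X in _ * X]mxE mulr0 addr0; split; first by rewrite oppr_le0.
  move=> /eqP; rewrite oppr_eq0 => /eqP/(adapted_quad_eq0 aX) xD.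
  exact: (bent_crossing0 aX EL EF xL xD kz).
have uz : u = 0 by apply/eqP; rewrite eq_le u_le0 u0.
rewrite {1 2}uz mulr0 sub0r mulN1r; split; first by lra.
move=> dk; have xD : x *m D = 0 by apply: (adapted_quad_eq0 aX); lra.
by apply: (bent_crossing0 aX EL EF xL xD); apply: dotrv_eq0; rewrite -/k; lra.
Qed.

Lemma crossing_coord t (v : 'rV[R]_(n + n)) : (v <= l t :&: L0)%MS ->
  exists2 x : 'rV[R]_n, v = x *m Y (t - a) & (x *m Y (t - a) <= L0)%MS.
Proof.
rewrite sub_capmx (rproj_eqmx (fY _).1) => /andP[/submxP[x ->] xL].
by exists x.
Qed.

Variable Wc : R -> 'M[R]_(n + n).
Hypothesis lWc : forall t, lagr Om (Wc t) /\
  (Wc t :&: l t == (0 : 'M[R]_(n + n)))%MS.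

Local Notation Gam t := (crossing_form Om l t (Wc t)).

Let GamE t x : Gam t (x *m Y (t - a)) = bent_quad (t - a) x.
Proof. by have [lW Wl] := lWc t; exact: bent_crossing_form. Qed.

(** Before the right end the form is negative definite on the crossing space, so testing [x] against
    itself suffices. At the right end the two terms have opposite signs and [k] must be killed
    first. *)
Lemma bent_nondeg t : a <= t <= a + 1 -> nondeg_on (Gam t) (l t :&: L0)%MS.
Proof.
move=> /andP[ta tb] _ /crossing_coord[x -> xL] Gx.
have Gp (y : 'rV[R]_n) : (y *m Y (t - a) <= L0)%MS ->
    - (x *m D *m y^T) 0 0 + (2 * (t - a) - 1) *
    (x *m pencil X2 X1 (t - a) *m Om *m F^T *m
      (y *m pencil X2 X1 (t - a) *m Om *m F^T)^T) 0 0 = 0.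
  move=> yL; have := Gx (y *m Y (t - a)).
  rewrite sub_capmx (rproj_eqmx (fY _).1) submxMl yL => /(_ isT).
  by rewrite -mulmxDl !GamE bent_quad_polar; lra.
suff -> : x = 0 by rewrite mul0mx.
have [tlt|tge] := ltP (t - a) 1.
  have [|_] := bent_quad_le0 _ xL; first by rewrite subr_ge0 ta.
  by apply; exact: (Gp x xL).
have t1 : t - a = 1 by lra.
move: xL Gp; rewrite t1 => xL Gp.
have P1 : pencil X2 X1 1 = X1 by rewrite /pencil scale1r addrC subrK.
set k := x *m pencil X2 X1 1 *m Om *m F^T in Gp.
have EX1 : (E <= X1)%MS by rewrite EL (submx_trans (capmxSl _ _))// capmxSl.
have /submxP[w Ew] : (E <= X2)%MS.
  by rewrite EL (submx_trans (capmxSl _ _))// capmxSr.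
(* The vector [k *m E] lies in [X1 :&: X2 :&: L0], so its coordinates [y] are in the kernel of [D],
   and its pairing with [F] is [k]. Testing [x] against it therefore gives [k k^T = 0]. *)
have [y yX1] : exists y : 'rV[R]_n, y *m X1 = k *m E.
  by have /submxP[y ->] := submx_trans (submxMl k E) EX1; exists y.
have [[_ X20] _ DT _ [X21 _]] := aX.
have yD : y *m D = 0.
  have -> : D = X1 *m Om *m X2^T.
    by rewrite -[RHS]opprK -tr_form// X21 linearN /= DT opprK.
  rewrite !mulmxA yX1 Ew !mulmxA -(mulmxA _ X2) -(mulmxA _ (X2 *m Om)) X20.
  by rewrite mulmx0.
have k0 : k = 0.
  have := Gp y; rewrite (bent1 Om X2 X1 F) yX1 P1 yX1.
  have -> : (k *m E <= L0)%MS by rewrite (submx_trans (submxMl _ _))// EL capmxSr.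
  move=> /(_ isT); have -> : (x *m D *m y^T) = 0.
    by apply: trmx_inj; rewrite trmx0 !trmx_mul trmxK DT mulmxA yD mul0mx.
  rewrite -2!(mulmxA k) EF mulmx1 mxE => h.
  by apply: dotrv_eq0; lra.
have xD : x *m D = 0.
  apply: (adapted_quad_eq0 aX); have := Gp x xL.
  by rewrite -/k k0 mul0mx [X in _ * X]mxE; lra.
exact: (bent_crossing0 aX EL EF xL xD k0).
Qed.

Lemma bent_n_plus t : a <= t < a + 1 -> n_plus (Gam t) (l t :&: L0)%MS = 0%N.
Proof.
move=> /andP[ta tb]; apply: n_plus_eq0 => _ /crossing_coord[x -> xL].
by rewrite GamE; apply: (bent_quad_le0 _ xL).1; rewrite subr_ge0 ta ltrBlDl.
Qed.

(** Inside, the negative index is at most the dimension of the crossing space. At [a + 1], [D] is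
    definite on any negative subspace, which can thus serve as [C] in [bent_crossing_rank]. The
    bound on [size s] will give finiteness of the crossings. *)
Lemma bent_crossing_bound (s : seq R) : uniq s ->
    (forall t, t \in s -> a < t < a + 1 /\ crossing L0 l t) ->
  (\sum_(t <- s) n_minus (Gam t) (l t :&: L0)%MS
    + n_minus (Gam (a + 1)) (l (a + 1)%R :&: L0)%MS
    + \rank (X1 :&: X2 + X2 :&: L0)%MS <= n)%N /\ (size s <= n)%N.
Proof.
move=> us sP.
have us' : uniq [seq t - a | t <- s] by rewrite map_inj_uniq//; exact: addIr.
have s01 : {in [seq t - a | t <- s], forall u, 0 < u < 1}.
  move=> _ /mapP[t /sP[/andP[t0 t1] _] ->].
  by rewrite subr_gt0 t0 ltrBlDl t1.
have rlE t : \rank (l t :&: L0)%MS = \rank (Y (t - a)%R :&: L0)%MS.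
  by apply/eqmx_rank/eqmxP/cap_eqmx => //; exact: (rproj_eqmx (fY _).1).
have count q (C : 'M[R]_(q, n)) : (C *m X1 <= L0)%MS -> definite_on D C ->
    (\sum_(t <- s) \rank (l t :&: L0)%MS + \rank C
      + \rank (X1 :&: X2 + X2 :&: L0)%MS <= n)%N.
  move=> CL dC; have := bent_crossing_rank OmS aX lL0 EL EF F0 us' s01 CL dC.
  by rewrite big_map (eq_bigr _ (fun t _ => rlE t)).
split; last first.
  have := count n 0; rewrite mul0mx sub0mx mxrank0 addn0 => /(_ isT).
  have d0 : definite_on D (0 : 'M[R]_n) by move=> x; rewrite submx0 => /eqP.
  move=> /(_ d0) /(leq_trans (leq_addr _ _)); apply: leq_trans.
  rewrite -sum1_size big_seq [X in (_ <= X)%N]big_seq; apply: leq_sum => t ts.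
  by rewrite lt0n mxrank_eq0; have [_] := sP t ts.
have sum_le : (\sum_(t <- s) n_minus (Gam t) (l t :&: L0)%MS <=
    \sum_(t <- s) \rank (l t :&: L0)%MS)%N.
  by apply: leq_sum => t _; apply: n_plus_le => U US _; exact: mxrankS.
(* This subtraction is truncated; the count with [C = 0] shows that the amount subtracted is at most
   [n]. *)
suff : (n_minus (Gam (a + 1)) (l (a + 1)%R :&: L0)%MS <=
    n - (\sum_(t <- s) \rank (l t :&: L0)%MS
          + \rank (X1 :&: X2 + X2 :&: L0)%MS))%N.
  have := count n 0; rewrite mul0mx sub0mx mxrank0 addn0 => /(_ isT).
  have d0 : definite_on D (0 : 'M[R]_n) by move=> x; rewrite submx0 => /eqP.
  move=> /(_ d0); move: sum_le; lia.
apply: n_plus_le => U US pU.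
have a1 : a + 1 - a = 1 by rewrite addrC addKr.
have UX1 : (U <= X1)%MS.
  apply: (submx_trans US); apply: (submx_trans (capmxSl _ _)).
  by rewrite (rproj_eqmx (fY _).1) a1 bent1.
have UC : U *m pinvmx X1 *m X1 = U by rewrite mulmxKpV.
have := count _ (U *m pinvmx X1); rewrite UC (submx_trans US) ?capmxSr//.
move=> /(_ isT) cU.
have rU : (\rank U <= \rank (U *m pinvmx X1))%N by rewrite -{1}UC mxrankM_maxl.
suff /cU : definite_on D (U *m pinvmx X1) by move: rU; lia.
move=> x xU /eqP xD; apply/eqP; apply: contraTT isT => xn0.
have [[fX2 _] [fX1 _] _ _ _] := aX.
(* If [x D x^T = 0], the form at [a + 1] reduces to the squared norm of [k], which cannot be
   negative. *)
have : 0 < - Gam (a + 1) (x *m X1).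
  apply: pU; first by rewrite -UC submxMr.
  by apply: contraNneq xn0 => xX1; apply/eqP/(row_free_inj fX1); rewrite xX1 mul0mx.
have -> : x *m X1 = x *m Y (a + 1 - a) by rewrite a1 bent1.
rewrite GamE a1 /bent_quad (eqP xD).
set k := x *m pencil _ _ _ *m Om *m F^T; have := dotrv_ge0 k; lra.
Qed.

End Bent.
End PencilIndex.

(** * Comparison of the two indices *)

Section Main.
Variables (R : realType) (n : nat) (Om : 'M[R]_(n + n)).
Hypothesis OmS : sympl_form Om.
Variable iota : 'M[R]_(n + n) -> (R -> 'M[R]_(n + n)) -> R -> R -> int.
Hypothesis CLM : is_CLM Om iota.
Variable L0 : 'M[R]_(n + n).
Hypothesis lL0 : lagr Om L0.

(** The bent pencil has the same index and only regular crossings. The crossing formula gives minus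
    a sum of negative indices, which [bent_crossing_bound] controls. *)
Lemma pencil_index X2 X1 D a : adapted Om X2 X1 D ->
  (\rank (X1 :&: X2 + X2 :&: L0)%MS)%:Z - n%:Z
    <= iota L0 (fun t => rproj (pencil X2 X1 (t - a))) a (a + 1) <= 0.
Proof.
move=> aX; pose E := row_base (X1 :&: X2 :&: L0)%MS.
have EL : (E :=: X1 :&: X2 :&: L0)%MS by exact: eq_row_base.
have E0 : E *m Om *m E^T = 0.
  by apply: (lagr_isotropic lL0); rewrite EL capmxSr.
have [F [EF F0]] := isotropic_dual OmS.1 OmS.2 (row_base_free _) E0.
have aa1 : a <= a + 1 by rewrite lerDl.
pose l t := rproj (bent_pencil Om X2 X1 F (t - a)).
have -> : iota L0 (fun t => rproj (pencil X2 X1 (t - a))) a (a + 1) =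
    iota L0 l a (a + 1).
  (* The factor [s] switches the bending on; the shear parameter is zero at both ends for every
     [s]. *)
  apply: (iota_homotopy CLM lL0 (X := fun s t => pencil X2 X1 (t - a) *m
    shear Om F (s * ((t - a) ^+ 2 - (t - a))))) => //.
  - move=> s t _ _; apply: frame_sympl => //; last exact: shear_sympl.
    exact: pencil_frame aX _.
  - apply: continuous_subspaceT => p.
    have cu : (q.2 - a) @[q --> p] --> p.2 - a.
      by apply: cvgB; [exact: cvg_snd|exact: cvg_cst].
    apply: cvg_mulmx; first exact: cvg_pencil.
    apply: cvg_shear; apply: cvgM; first exact: cvg_fst.
    by apply: cvgB => //; rewrite expr2; apply: cvgM.
  - by move=> t _; rewrite mul0r mul1r shear0 mulmx1.
  - move=> s _; have -> : a + 1 - a = 1 by rewrite addrC addKr.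
    by rewrite subrr expr0n expr1n /= !subrr !mulr0.
have fl t : frame Om (bent_pencil Om X2 X1 F (t - a)).
  exact: (bent_frame OmS aX F0).
have [Wc lWc] := choice (fun t => lagr_transversal OmS (fl t)).
have crP := bent_crossing_bound OmS aX lL0 EL EF F0 lWc.
have [s us sP] := @bounded_uniq_list R
  (fun t => a < t < a + 1 /\ crossing L0 l t) n (fun s us h => (crP s us h).2).
have [_ [_ reg]] := CLM.
have lE : l = (fun t => rproj (evmx t (bent_poly Om X2 X1 F a))).
  by apply/funext => t; rewrite bent_polyE.
have [dl cl] : (forall t, derivable l t 1) /\ continuous ('D_1 l).
  by rewrite lE; apply: rproj_evmx_C1 => t; rewrite bent_polyE; exact: (fl t).1.
rewrite (reg L0 l Wc a (a + 1) s lL0) ?ltrDl//; last 2 first.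
- by move=> t; exact: frame_lagr (fl t).
- by move=> t t01 _; exact: (bent_nondeg OmS aX lL0 EL EF F0 lWc).
rewrite (bent_n_plus OmS aX lL0 EL EF F0 lWc) ?lexx ?ltrDl ?ltr01//.
have cr : (\sum_(t <- s) n_minus (crossing_form Om l t (Wc t)) (l t :&: L0)%MS
    + n_minus (crossing_form Om l (a + 1)%R (Wc (a + 1)%R)) (l (a + 1)%R :&: L0)%MS
    + \rank (X1 :&: X2 + X2 :&: L0)%MS <= n)%N.
  exact: (crP s us (fun t => (sP t).1)).1.
have -> : \sum_(t <- s) sgn_form (crossing_form Om l t (Wc t)) (l t :&: L0)%MS =
    - (\sum_(t <- s) n_minus (crossing_form Om l t (Wc t)) (l t :&: L0)%MS)%N%:Z.
  rewrite (big_morph Posz (id1 := 0) (op1 := +%R)) // -sumrN.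
  rewrite big_seq [RHS]big_seq; apply: eq_bigr => t /sP[/andP[t0 t1] _].
  by rewrite /sgn_form (bent_n_plus OmS aX lL0 EL EF F0 lWc) ?ltW//; exact: sub0r.
have arith (i j k N : nat) : (i + j + k <= N)%N ->
    k%:Z - N%:Z <= 0%N%:Z - i%:Z - j%:Z <= 0 by lia.
exact: (arith _ _ _ _ cr).
Qed.

Definition clamp01 (t : R) : R := Num.min (Num.max t 0) 1.

Lemma clamp01_le0 t : t <= 0 -> clamp01 t = 0.
Proof. by move=> t0; rewrite /clamp01 max_r// min_l. Qed.

Lemma clamp01_ge1 t : 1 <= t -> clamp01 t = 1.
Proof.
by move=> t1; rewrite /clamp01 max_l ?min_r// (le_trans ler01).
Qed.

Lemma clamp01_id t : 0 <= t <= 1 -> clamp01 t = t.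
Proof. by move=> /andP[t0 t1]; rewrite /clamp01 max_l// min_l. Qed.

(** The constant path is the pencil of [X] with itself, where [D = 0]; the bounds of [pencil_index]
    then both become [0]. *)
Lemma constant_index X a : frame Om X -> iota L0 (fun=> rproj X) a (a + 1) = 0.
Proof.
move=> fX; have := pencil_index a (adapted_const fX).
have -> : (fun t => rproj (pencil X X (t - a))) = (fun=> rproj X).
  by apply/funext => t; rewrite /pencil subrr scaler0 addr0.
have : (n <= \rank (X :&: X + X :&: L0)%MS)%N.
  rewrite -[X in (X <= _)%N](eqP fX.1); apply: mxrankS.
  by apply: submx_trans (addsmxSl _ _); rewrite sub_capmx !submx_refl.
have arith (k N : nat) (z : int) : (N <= k)%N -> k%:Z - N%:Z <= z <= 0 -> z = 0.
  by lia.
exact: arith.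
Qed.

(** Two routes lead from [X2] to [X1 *m psi T] over [[-1, T + 1]]: wait, follow [l2], run the moved
    pencil; or run the pencil, follow [l1], wait. They are homotopic with fixed ends, and waiting
    contributes zero. *)
Lemma index_difference X2 X1 D (psi : R -> 'M[R]_(n + n)) (T : R)
    (l1 l2 : R -> 'M[R]_(n + n)) : adapted Om X2 X1 D -> 0 < T ->
    {within [set t | 0 <= t <= T], continuous psi} ->
    (forall t, 0 <= t <= T -> sympl_map Om (psi t)) -> psi 0 = 1%:M ->
    (forall t, 0 <= t <= T -> l1 t = rproj (X1 *m psi t)) ->
    (forall t, 0 <= t <= T -> l2 t = rproj (X2 *m psi t)) ->
  iota L0 l1 0 T - iota L0 l2 0 T =
  iota L0 (fun t => rproj (pencil (X2 *m psi T) (X1 *m psi T) (t - T))) T (T + 1)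
  - iota L0 (fun t => rproj (pencil X2 X1 (t - (-1)))) (-1) 0.
Proof.
move=> aX T0 cpsi spsi psi0 l1E l2E.
(* [clamp01 (t + 1)] runs the pencil during [[-1, 0]] and [clamp01 (t - T)] during [[T, T + 1]]; [s]
   interpolates between these timings, while [ct] freezes [psi] outside [[0, T]]. *)
pose r s t := s * clamp01 (t + 1) + (1 - s) * clamp01 (t - T).
pose ct (t : R) := Num.min (Num.max t 0) T.
pose X s t := pencil X2 X1 (r s t) *m psi (ct t).
have ct_itv t : 0 <= ct t <= T.
  by rewrite /ct le_min ge_min lexx (ltW T0) orbT le_max lexx orbT.
have ct_le0 t : t <= 0 -> ct t = 0.
  by move=> t0; rewrite /ct max_r// min_l// ltW.
have ct_geT t : T <= t -> ct t = T.
  by move=> tT; rewrite /ct max_l ?min_r// (le_trans (ltW T0)).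
have ct_id t : 0 <= t <= T -> ct t = t.
  by move=> /andP[t0 tT]; rewrite /ct max_l// min_l.
have fX s t : frame Om (X s t).
  by apply: frame_sympl => //; [exact: pencil_frame aX _|exact: spsi].
have cmin (T' : topologicalType) (f g : T' -> R) (x : T') :
    f y @[y --> x] --> f x -> g y @[y --> x] --> g x ->
    Num.min (f y) (g y) @[y --> x] --> Num.min (f x) (g x).
  exact: continuous_min.
have cmax (T' : topologicalType) (f g : T' -> R) (x : T') :
    f y @[y --> x] --> f x -> g y @[y --> x] --> g x ->
    Num.max (f y) (g y) @[y --> x] --> Num.max (f x) (g x).
  exact: continuous_max.
have ccl : continuous clamp01.
  move=> t; apply: cmin; last exact: cvg_cst.
  by apply: cmax; [exact: cvg_id|exact: cvg_cst].
have cct : continuous ct.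
  move=> t; apply: cmin; last exact: cvg_cst.
  by apply: cmax; [exact: cvg_id|exact: cvg_cst].
have cX : {within [set p : R * R | 0 <= p.1 <= 1 /\ -1 <= p.2 <= T + 1],
    continuous (fun p : R * R => X p.1 p.2)}.
  apply/subspace_continuousP => p Ap; apply: cvg_mulmx.
    apply: cvg_within_filter; apply: cvg_pencil.
    have c2 (c : R) : (clamp01 (q.2 + c)) @[q --> p] --> clamp01 (p.2 + c).
      apply: continuous_cvg; first exact: ccl.
      by apply: cvgD; [exact: cvg_snd|exact: cvg_cst].
    apply: cvgD; apply: cvgM => //; first exact: cvg_fst.
    by apply: cvgB; [exact: cvg_cst|exact: cvg_fst].
  have cc : {within [set p : R * R | 0 <= p.1 <= 1 /\ -1 <= p.2 <= T + 1],
      continuous (fun p : R * R => ct p.2)}.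
    apply: continuous_subspaceT => q.
    by apply: continuous_cvg; [exact: cct|exact: cvg_snd].
  have cpc : {within [set p : R * R | 0 <= p.1 <= 1 /\ -1 <= p.2 <= T + 1],
      continuous (psi \o (fun p : R * R => ct p.2))}.
    by apply: (within_continuous_comp _ cc cpsi) => q _; exact: ct_itv.
  exact: (subspace_continuousP _ _).1 cpc p Ap.
have cXs s a b : 0 <= s <= 1 -> -1 <= a -> b <= T + 1 ->
    {within [set t | a <= t <= b], continuous (X s)}.
  move=> s01 a1 bT; apply: continuous_subspaceW (within_slice s01 cX).
  by move=> t /= /andP[ta tb]; rewrite (le_trans a1 ta) (le_trans tb bT).
have i0 : 0 <= (0 : R) <= 1 by rewrite lexx ler01.
have i1 : 0 <= (1 : R) <= 1 by rewrite lexx ler01.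
have N1T : -1 <= T + 1 by lra.
have leN10 : -1 <= 0 :> R by lra.
have hom : iota L0 (fun t => rproj (X 0 t)) (-1) (T + 1) =
           iota L0 (fun t => rproj (X 1 t)) (-1) (T + 1).
  apply: (iota_homotopy CLM lL0 N1T _ cX) => // s _; split.
    by rewrite /X /r addNr !clamp01_le0 ?lexx//; [rewrite !mulr0|lra].
  rewrite /X /r !clamp01_ge1; [|lra|lra].
  by rewrite !mulr1 ![_ + (1 - _)]addrC !subrK.
have [_ [add _]] := CLM.
have split3 s : 0 <= s <= 1 -> iota L0 (fun t => rproj (X s t)) (-1) (T + 1) =
    iota L0 (fun t => rproj (X s t)) (-1) 0 +
    (iota L0 (fun t => rproj (X s t)) 0 T +
     iota L0 (fun t => rproj (X s t)) T (T + 1)).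
  move=> s01; have lp a b : -1 <= a -> b <= T + 1 ->
      lag_path Om (fun t => rproj (X s t)) a b.
    by move=> a1 bT; apply: (lag_path_frame (X := X s)) => //; exact: cXs.
  have le0T1 : 0 <= T + 1 by lra.
  have leTT1 : T <= T + 1 by lra.
  rewrite (add _ _ _ _ _ lL0 leN10 le0T1 (lp _ _ (lexx _) (lexx _))).
  by rewrite (add _ _ _ _ _ lL0 (ltW T0) leTT1 (lp _ _ leN10 (lexx _))).
have piece s a b l : 0 <= s <= 1 -> -1 <= a -> a <= b -> b <= T + 1 ->
    (forall t, a <= t <= b -> l t = rproj (X s t)) ->
    iota L0 (fun t => rproj (X s t)) a b = iota L0 l a b.
  move=> s01 a1 ab bT lX; apply: (iota_eq CLM lL0 (X := X s)) => //.
  - exact: cXs.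
  - by move=> t /lX.
have P0 Y2 Y1 : pencil Y2 Y1 0 = Y2 :> 'M[R]_(n, n + n).
  by rewrite /pencil scale0r addr0.
have P1 Y2 Y1 : pencil Y2 Y1 1 = Y1 :> 'M[R]_(n, n + n).
  by rewrite /pencil scale1r addrC subrK.
have le1T1 : -1 <= T by lra.
have leTT1 : T <= T + 1 by lra.
have le0T1 : 0 <= T + 1 by lra.
have [fX2 fX1 _ _ _] := aX.
have p01 : iota L0 (fun t => rproj (X 0 t)) (-1) 0 = 0.
  rewrite (piece 0 (-1) 0 (fun=> rproj X2)) //.
    by have := constant_index (-1) fX2; rewrite addNr.
  move=> t /andP[t1 t0]; rewrite /X /r ct_le0// mul0r add0r clamp01_le0.
    by rewrite mulr0 P0 psi0 mulmx1.
  by lra.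
have p02 : iota L0 (fun t => rproj (X 0 t)) 0 T = iota L0 l2 0 T.
  apply: piece => //; [exact: ltW|move=> t t0T].
  rewrite l2E// /X /r ct_id// mul0r add0r clamp01_le0.
    by rewrite mulr0 P0.
  by move: t0T => /andP[]; lra.
have p03 : iota L0 (fun t => rproj (X 0 t)) T (T + 1) = iota L0
    (fun t => rproj (pencil (X2 *m psi T) (X1 *m psi T) (t - T))) T (T + 1).
  apply: piece => // t /andP[tT tT1].
  rewrite /X /r ct_geT// mul0r add0r subr0 mul1r clamp01_id ?pencil_mul//.
  by apply/andP; split; lra.
have p11 : iota L0 (fun t => rproj (X 1 t)) (-1) 0 =
    iota L0 (fun t => rproj (pencil X2 X1 (t - -1))) (-1) 0.
  apply: piece => // t /andP[t1 t0].
  rewrite /X /r ct_le0// subrr mul0r addr0 mul1r psi0 mulmx1 opprK.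
  by rewrite clamp01_id//; apply/andP; split; lra.
have p12 : iota L0 (fun t => rproj (X 1 t)) 0 T = iota L0 l1 0 T.
  apply: piece => //; [exact: ltW|move=> t t0T].
  rewrite l1E// /X /r ct_id// subrr mul0r addr0 mul1r clamp01_ge1 ?P1//.
  by move: t0T => /andP[]; lra.
have p13 : iota L0 (fun t => rproj (X 1 t)) T (T + 1) = 0.
  rewrite (piece 1 T (T + 1) (fun=> rproj (X1 *m psi T))) //.
    apply/constant_index/frame_sympl => //; apply: spsi.
    by rewrite lexx ltW.
  move=> t /andP[tT tT1].
  rewrite /X /r ct_geT// subrr mul0r addr0 mul1r clamp01_ge1 ?P1//; lra.
move: hom; rewrite !split3// p01 p02 p03 p11 p12 p13.
lia.
Qed.

(** The moved pencil is adapted with the same [D], so both indices lie in [[k - n, 0]], an interval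
    of length [n - k]. *)
Lemma adapted_bound X2 X1 D psi k : adapted Om X2 X1 D -> sympl_map Om psi ->
    (k <= \rank (X1 :&: X2 + X2 :&: L0)%MS)%N ->
    (k <= \rank (X1 *m psi :&: X2 *m psi + X2 *m psi :&: L0)%MS)%N ->
    forall a b,
  `| iota L0 (fun t => rproj (pencil (X2 *m psi) (X1 *m psi) (t - a))) a (a + 1)
    - iota L0 (fun t => rproj (pencil X2 X1 (t - b))) b (b + 1) |
    <= n%:Z - k%:Z.
Proof.
move=> aX Spsi ka kb a b.
have arith (i j N c : nat) (x y : int) : (c <= i)%N -> (c <= j)%N ->
    i%:Z - N%:Z <= x <= 0 -> j%:Z - N%:Z <= y <= 0 -> `|y - x| <= N%:Z - c%:Z.
  by lia.
apply: arith ka kb (pencil_index b aX) _.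
exact: pencil_index (adapted_sympl OmS aX Spsi).
Qed.

End Main.

Theorem theorem2p9 (R : realType) (n : nat) (Om : 'M[R]_(n + n))
  (iota : 'M[R]_(n + n) -> (R -> 'M[R]_(n + n)) -> R -> R -> int)
  (L0 L1 L2 : 'M[R]_(n + n)) (psi : R -> 'M[R]_(n + n)) (T : R) :
  sympl_form Om ->
  is_CLM Om iota ->
  lagr Om L0 -> lagr Om L1 -> lagr Om L2 ->
  0 < T ->
  {within [set t | 0 <= t <= T], continuous psi} ->
  (forall t, 0 <= t <= T -> sympl_map Om (psi t)) ->
  psi 0 = 1%:M ->
  let l1 := fun t => oproj (L1 *m psi t) in
  let l2 := fun t => oproj (L2 *m psi t) in
  let mu0 := fun t => oproj (L0 *m invmx (psi t)) in
  let eps_a := (L1 :&: L2 + L2 :&: L0)%MS in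
  let eps_b := (L1 :&: L2 + L2 :&: mu0 T)%MS in
  let k := minn (\rank eps_a) (\rank eps_b) in
  `| iota L0 l1 0 T - iota L0 l2 0 T | <= n%:Z - k%:Z.
Proof.
move=> OmS CLM lL0 lL1 lL2 T0 cpsi spsi psi0; cbv beta zeta.
set mu := oproj (L0 *m _); set eps_b := (_ + L2 :&: mu)%MS; set k := minn _ _.
have [Y1 [fY1 LY1]] := lagr_frame lL1.
have [Y2 [fY2 LY2]] := lagr_frame lL2.
have [X2 [X1 [D [aX XY2 XY1]]]] := adapted_exists OmS fY2 fY1.
have LX1 : (L1 :=: X1)%MS := eqmx_trans LY1 (eqmx_sym XY1).
have LX2 : (L2 :=: X2)%MS := eqmx_trans LY2 (eqmx_sym XY2).
have [fX2 fX1 _ _ _] := aX.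
have lE (L : 'M[R]_(n + n)) X t : frame Om X -> (L :=: X)%MS -> 0 <= t <= T ->
    oproj (L *m psi t) = rproj (X *m psi t).
  move=> fX LX t0T; apply: oproj_rproj; last exact: eqmxMr.
  by have [] := frame_sympl OmS fX (spsi t t0T).
have T0T : 0 <= T <= T by rewrite lexx ltW.
have uT : psi T \in unitmx by exact: (sympl_map_unitmx OmS (spsi T T0T)).
have muE : (mu :=: L0 *m invmx (psi T))%MS.
  apply: eqmx_trans (eq_row_base (L0 *m invmx (psi T))).
  by rewrite /mu /oproj -rprojE ?row_base_free//; apply/rproj_eqmx/row_base_free.
rewrite (index_difference OmS CLM lL0 aX T0 cpsi spsi psi0
  (fun t => lE L1 X1 t fX1 LX1) (fun t => lE L2 X2 t fX2 LX2)).
have := adapted_bound OmS CLM lL0 (k := k) aX (spsi T T0T) _ _ T (-1).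
rewrite addNr; apply.
  apply: leq_trans (geq_minl _ _) _; apply: mxrankS; apply: addsmxS.
    by apply: capmxS; rewrite ?LX1 ?LX2.
  by apply: capmxS; rewrite ?LX2.
apply: leq_trans (geq_minr _ _) _.
(* The invertible [psi T] preserves the rank of [eps_b] and carries [mu] back to [L0], which turns
   [eps_b] into the sum attached to the moved pencil. *)
rewrite -(mxrankMfree eps_b (B := psi T)) ?row_free_unit//.
apply: mxrankS; rewrite addsmxMr; apply: addsmxS.
  apply: submx_trans (capmxMr _ _ _) _.
  by apply: capmxS; apply: submxMr; rewrite ?LX1 ?LX2.
apply: submx_trans (capmxMr _ _ _) _; apply: capmxS.
  by apply: submxMr; rewrite LX2.
have : (mu *m psi T <= L0 *m invmx (psi T) *m psi T)%MS.
  by apply: submxMr; rewrite muE.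
by rewrite mulmxKV.
Qed.
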